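(* Let $N:\mathbf{Opd}\to\mathbf{Coll}$ be the forgetful functor from globular operads to collections and let $M\dashv N$ be its left adjoint (so $M:\mathbf{Coll}\to\mathbf{Opd}$ is the free operad functor). Then the adjunction $M\dashv N$ decomposes as a chain of adjunctions $$\cdots\ \ \mathbf{Opd}_{k+1}\ \underset{M_{k+1}}{\overset{N_{k+1}}{\rightleftarrows}}\ \mathbf{Opd}_k\ \underset{M_k}{\overset{N_k}{\rightleftarrows}}\ \mathbf{Opd}_{k-1}\ \cdots\ \underset{M_1}{\overset{N_1}{\rightleftarrows}}\ \mathbf{Opd}_0\ \underset{M_0}{\overset{N_0}{\rightleftarrows}}\ \mathbf{Coll},\qquad M_k\dashv N_k,$$ where each $N_k$ is the functor forgetting the $k$th dimension of operad structure. That is, for each $k\ge 0$ the functor $N_k$ has a left adjoint $M_k$, with the following properties for each $k\geq 0$: (i) $M_k$ leaves all dimensions unchanged except the $k$th dimension, and preserves the underlying $(k-1)$-operad structure; and (ii) for every collection $A$, the underlying $k$-operad of $MA$ is that of $M_kM_{k-1}\cdots M_0A$.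
   Context: A globular set $A$ consists of sets $A(k)=A_k$ ($k\ge 0$) of $k$-cells and maps $s,t:A_{k}\to A_{k-1}$ ($k\ge1$) with $ss=st$ and $ts=tt$; morphisms are families of maps commuting with $s$ and $t$. The category is $\mathbf{GSet}$. Let $T$ be the free strict $\omega$-category monad on $\mathbf{GSet}$, with unit $\eta$ and multiplication $\mu$, and let $1$ be the terminal globular set (one cell in each dimension). The category $\mathbf{Coll}$ of collections is the slice category $\mathbf{GSet}/T1$. It is monoidal: the tensor product of $d:A\to T1$ and $d':A'\to T1$ is the pullback $A\otimes A'$ of $d:A\to T1$ along $T!:TA'\to T1$, with structure map $A\otimes A'\to TA'\xrightarrow{Td'}T^21\xrightarrow{\mu_1}T1$; the unit is $\eta_1:1\to T1$. A (globular) operad is a monoid in $\mathbf{Coll}$; $\mathbf{Opd}$ is the category of operads and monoid maps. It is known that $N:\mathbf{Opd}\to\mathbf{Coll}$ is monadic. The underlying $k$-collection of a collection is obtained by discarding all cells of dimension $>k$ (in $A$ and in $T1$). Since the cells of dimension $\le k$ of $A\otimes A'$ depend only on the cells of dimension $\le k$ of $A$ and $A'$, $k$-collections inherit a truncated monoidal structure; a $k$-operad is a monoid for it. For $k\ge0$, $\mathbf{Opd}_k$ is the category whose objects are (full, not truncated) collections whose underlying $k$-collection is equipped with the structure of a $k$-operad; morphisms are morphisms of collections preserving the $k$-operad structure. By convention $\mathbf{Opd}_{-1}=\mathbf{Coll}$ (no operad structure), so for $k=0$ the second clause of (i) is vacuous. The functor $N_k:\mathbf{Opd}_k\to\mathbf{Opd}_{k-1}$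 is the identity on underlying collections and forgets the part of the operad structure in dimension $k$. ''$M_k$ leaves dimension $m$ unchanged'' means that $M_kX$ has the same $m$-cells, over $T1$, as $X$. As left adjoints are determined only up to canonical isomorphism, identifications involving them are understood with suitable choices, or up to canonical isomorphism. *)

(* Defs.v *)
From mathcomp Require Import all_boot.
From Stdlib Require Import FunctionalExtensionality ProofIrrelevance.
From Stdlib Require Import ClassicalEpsilon PropExtensionality.

Set Implicit Arguments.
Unset Strict Implicit.
Unset Printing Implicit Defensive.

#[local] Obligation Tactic := idtac.

Record category := Category {
  obj :> Type;
  hom : obj -> obj -> Type;
  idm : forall X, hom X X;
  cmp : forall X Y Z, hom Y Z -> hom X Y -> hom X Z;
  cmp1m : forall X Y (f : hom X Y), cmp (idm Y) f = f;
  cmpm1 : forall X Y (f : hom X Y), cmp f (idm X) = f;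
  cmpA : forall X Y Z W (h : hom Z W) (g : hom Y Z) (f : hom X Y),
    cmp h (cmp g f) = cmp (cmp h g) f
}.
Arguments idm {c} X.
Arguments cmp {c X Y Z} _ _.

Declare Scope cat_scope.
Delimit Scope cat_scope with cat.
Local Open Scope cat_scope.
Notation "g ∘ f" := (cmp g f) (at level 40, left associativity) : cat_scope.

Definition is_iso (C : category) (X Y : C) (f : hom X Y) : Prop :=
  exists g : hom Y X, g ∘ f = idm X /\ f ∘ g = idm Y.

Record functor (C D : category) := Functor {
  fobj :> C -> D;
  fmap : forall X Y, hom X Y -> hom (fobj X) (fobj Y);
  fmap1 : forall X, fmap (idm X) = idm (fobj X);
  fmapM : forall X Y Z (g : hom Y Z) (f : hom X Y),
    fmap (g ∘ f) = fmap g ∘ fmap f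
}.
Arguments fmap {C D} f0 {X Y} _.

Definition functor_id (C : category) : functor C C :=
  @Functor C C (fun X => X) (fun X Y f => f) (fun X => erefl) (fun X Y Z g f => erefl).

Program Definition functor_cmp (C D E : category) (G : functor D E)
    (F : functor C D) : functor C E :=
  @Functor C E (fun X => G (F X)) (fun X Y f => fmap G (fmap F f)) _ _.
Next Obligation. by move=> C D E G F X /=; rewrite !fmap1. Qed.
Next Obligation. by move=> C D E G F X Y Z g f /=; rewrite !fmapM. Qed.

Record adjunction (C D : category) (F : functor D C) (G : functor C D) :=
Adjunction {
  adj_unit : forall X : D, hom X (G (F X));
  adj_counit : forall Y : C, hom (F (G Y)) Y;
  adj_unit_nat : forall (X X' : D) (f : hom X X'),
    adj_unit X' ∘ f = fmap G (fmap F f) ∘ adj_unit X;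
  adj_counit_nat : forall (Y Y' : C) (g : hom Y Y'),
    g ∘ adj_counit Y = adj_counit Y' ∘ fmap F (fmap G g);
  adj_triangle_l : forall X : D,
    adj_counit (F X) ∘ fmap F (adj_unit X) = idm (F X);
  adj_triangle_r : forall Y : C,
    fmap G (adj_counit Y) ∘ adj_unit (G Y) = idm (G Y)
}.

Record left_adjoint (C D : category) (G : functor C D) := LeftAdjoint {
  ladj :> functor D C;
  ladj_adj : adjunction ladj G
}.

Definition lunit (C D : category) (G : functor C D) (F : left_adjoint G)
  (X : D) : hom X (G (F X)) := adj_unit (ladj_adj F) X.

Section UniversalArrows.
Context (C D : category) (G : functor C D).
Context (F : D -> C) (u : forall X, hom X (G (F X))).
Context (lift : forall X Y, hom X (G Y) -> hom (F X) Y).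
Context (liftP : forall X Y (f : hom X (G Y)), fmap G (lift f) ∘ u X = f).
Context (lift_uniq : forall X Y (g : hom (F X) Y), lift (fmap G g ∘ u X) = g).

Local Lemma arrow_ext X Y (g g' : hom (F X) Y) :
  fmap G g ∘ u X = fmap G g' ∘ u X -> g = g'.
Proof. by move=> e; rewrite -(lift_uniq g) e lift_uniq. Qed.

Program Definition universal_functor : functor D C :=
  @Functor D C F (fun X Y f => lift (u Y ∘ f)) _ _.
Next Obligation. by move=> X; apply: arrow_ext; rewrite liftP fmap1 cmpm1 cmp1m. Qed.
Next Obligation.
move=> X Y Z g f; apply: arrow_ext.
by rewrite liftP fmapM -cmpA liftP !cmpA liftP.
Qed.

Program Definition universal_adjunction : adjunction universal_functor G :=
  @Adjunction C D universal_functor G u (fun Y => lift (idm (G Y))) _ _ _ _.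
Next Obligation. by move=> X X' f /=; rewrite liftP. Qed.
Next Obligation.
move=> Y Y' g /=; apply: arrow_ext.
by rewrite !fmapM -!cmpA !liftP cmpm1 cmpA liftP cmp1m.
Qed.
Next Obligation.
move=> X /=; apply: arrow_ext.
by rewrite fmapM -cmpA liftP cmpA liftP fmap1.
Qed.
Next Obligation. by move=> Y /=; rewrite liftP. Qed.

Definition universal_left_adjoint : left_adjoint G :=
  LeftAdjoint universal_adjunction.
End UniversalArrows.

Record gset := GSetObj {
  cell :> nat -> Type;
  src : forall k, cell k.+1 -> cell k;
  tgt : forall k, cell k.+1 -> cell k;
  src_tgt : forall k (x : cell k.+2), src (src x) = src (tgt x);
  tgt_src : forall k (x : cell k.+2), tgt (src x) = tgt (tgt x)
}.
Arguments src {g k} _.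
Arguments tgt {g k} _.

Record gmap (A B : gset) := GMap {
  gfun :> forall k, A k -> B k;
  gmap_src : forall k (x : A k.+1), gfun (src x) = src (gfun x);
  gmap_tgt : forall k (x : A k.+1), gfun (tgt x) = tgt (gfun x)
}.
Arguments gfun {A B} _ {k} _.

Lemma gmap_eq (A B : gset) (f g : gmap A B) :
  (forall k (x : A k), f k x = g k x) -> f = g.
Proof.
case: f g => [f fs ft] [g gs gt] /= e.
have efg : f = g.
  by apply: functional_extensionality_dep => k; apply: functional_extensionality.
by subst g; congr GMap; apply: proof_irrelevance.
Qed.

Definition gid (A : gset) : gmap A A :=
  @GMap A A (fun k x => x) (fun k x => erefl) (fun k x => erefl).

Program Definition gcomp (A B C : gset) (g : gmap B C) (f : gmap A B) :
  gmap A C := @GMap A C (fun k x => g k (f k x)) _ _.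
Next Obligation. by move=> A B C g f k x /=; rewrite !gmap_src. Qed.
Next Obligation. by move=> A B C g f k x /=; rewrite !gmap_tgt. Qed.

Program Definition GSet : category := @Category gset gmap gid gcomp _ _ _.
Next Obligation. by move=> A B f; apply: gmap_eq. Qed.
Next Obligation. by move=> A B f; apply: gmap_eq. Qed.
Next Obligation. by move=> A B C D h g f; apply: gmap_eq. Qed.

Definition gone : gset :=
  @GSetObj (fun _ => unit) (fun _ _ => tt) (fun _ _ => tt)
    (fun _ _ => erefl) (fun _ _ => erefl).

Definition bang (A : gset) : gmap A gone :=
  @GMap A gone (fun _ _ => tt) (fun _ _ => erefl) (fun _ _ => erefl).

(* For k-cells x and y, [composable j x y] says that j < k and that the
   j-dimensional target t^(k-j) x is the j-dimensional source s^(k-j) y.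
   The recursion on k avoids transporting cells along equations between
   dimensions. *)
Fixpoint composable (A : gset) (j k : nat) : A k -> A k -> Prop :=
  match k with
  | 0 => fun _ _ => False
  | k'.+1 => fun x y =>
      if j == k' then tgt x = src y else composable j (tgt x) (src y)
  end.

(* For j < k, [id_src i j x] is the k-dimensional iterated identity, formed with
   the identity operation i, on the j-dimensional source of the k-cell x. *)
Fixpoint id_src (A : gset) (i : forall k, A k -> A k.+1) (j k : nat) :
    A k -> A k :=
  match k with
  | 0 => fun x => x
  | k'.+1 => fun x => i k' (if j == k' then src x else id_src i j (src x))
  end.

Fixpoint id_tgt (A : gset) (i : forall k, A k -> A k.+1) (j k : nat) :
    A k -> A k :=
  match k with
  | 0 => fun x => x
  | k'.+1 => fun x => i k' (if j == k' then tgt x else id_tgt i j (tgt x))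
  end.

(* Composites are written in diagrammatic order: [ocomp h] with
   [h : composable j x y] is "x followed by y" along the common j-cell. The
   remaining composability proofs quantified over in the axioms always exist;
   see [composable_src] and [composable_tgt] for the boundary axioms. *)
Record omega_cat := OmegaCat {
  ogset :> gset;
  oid : forall k, ogset k -> ogset k.+1;
  ocomp : forall j k (x y : ogset k), composable j x y -> ogset k;
  oid_src : forall k (x : ogset k), src (oid x) = x;
  oid_tgt : forall k (x : ogset k), tgt (oid x) = x;
  ocomp_src_top : forall k (x y : ogset k.+1) (h : composable k x y),
    src (ocomp h) = src x;
  ocomp_tgt_top : forall k (x y : ogset k.+1) (h : composable k x y),
    tgt (ocomp h) = tgt y;
  ocomp_src : forall j k (x y : ogset k.+1) (h : composable j x y)
    (h' : composable j (src x) (src y)), j < k -> src (ocomp h) = ocomp h';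
  ocomp_tgt : forall j k (x y : ogset k.+1) (h : composable j x y)
    (h' : composable j (tgt x) (tgt y)), j < k -> tgt (ocomp h) = ocomp h';
  ocompA : forall j k (x y z : ogset k) (hxy : composable j x y)
    (hyz : composable j y z) (h1 : composable j (ocomp hxy) z)
    (h2 : composable j x (ocomp hyz)), ocomp h1 = ocomp h2;
  ocomp_idl : forall j k (x : ogset k) (h : composable j (id_src oid j x) x),
    ocomp h = x;
  ocomp_idr : forall j k (x : ogset k) (h : composable j x (id_tgt oid j x)),
    ocomp h = x;
  ocomp_interchange : forall i j k (x y x' y' : ogset k)
    (hxy : composable j x y) (hxy' : composable j x' y')
    (hx : composable i x x') (hy : composable i y y')
    (h1 : composable i (ocomp hxy) (ocomp hxy'))
    (h2 : composable j (ocomp hx) (ocomp hy)),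
    i < j -> ocomp h1 = ocomp h2;
  oid_comp : forall j k (x y : ogset k) (h : composable j x y)
    (h' : composable j (oid x) (oid y)), oid (ocomp h) = ocomp h'
}.
Arguments oid {o k} _.
Arguments ocomp {o j k x y} _.

Record omap (C D : omega_cat) := OMap {
  ogmap :> gmap C D;
  omap_id : forall k (x : C k), ogmap k.+1 (oid x) = oid (ogmap k x);
  omap_comp : forall j k (x y : C k) (h : composable j x y)
    (h' : composable j (ogmap k x) (ogmap k y)),
    ogmap k (ocomp h) = ocomp h'
}.

Lemma omap_eq (C D : omega_cat) (f g : omap C D) :
  (forall k (x : C k), f k x = g k x) -> f = g.
Proof.
case: f g => [f f1 fc] [g g1 gc] /= /gmap_eq efg; subst g.
by congr OMap; apply: proof_irrelevance.
Qed.

Lemma composable_map (A B : gset) (f : gmap A B) j k (x y : A k) :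
  composable j x y -> composable j (f k x) (f k y).
Proof.
elim: k x y => //= k IH x y; case: ifP => _ => [e | /IH].
  by rewrite -gmap_src -gmap_tgt e.
by rewrite gmap_src gmap_tgt.
Qed.

Lemma composable_lt (A : gset) j k (x y : A k) : composable j x y -> j < k.
Proof.
elim: k x y => //= k IH x y; case: eqP => [-> // | _ /IH]; exact: leqW.
Qed.

Lemma composable_src (A : gset) j k (x y : A k.+1) :
  j < k -> composable j x y -> composable j (src x) (src y).
Proof.
case: k x y => // k x y jk; rewrite [composable j x y]/=.
by rewrite (ltn_eqF jk) /= -tgt_src.
Qed.

Lemma composable_tgt (A : gset) j k (x y : A k.+1) :
  j < k -> composable j x y -> composable j (tgt x) (tgt y).
Proof.
case: k x y => // k x y jk; rewrite [composable j x y]/=.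
by rewrite (ltn_eqF jk) /= src_tgt.
Qed.

Definition oidm (C : omega_cat) : omap C C.
Proof.
apply: (@OMap C C (gid C)) => //= j k x y h h'.
by congr ocomp; apply: proof_irrelevance.
Defined.

Definition ocompm (C D E : omega_cat) (g : omap D E) (f : omap C D) : omap C E.
Proof.
apply: (@OMap C E (gcomp g f)) => /= [k x | j k x y h h'].
  by rewrite !omap_id.
by rewrite (omap_comp h (composable_map f h)) (omap_comp _ h').
Defined.

Program Definition OmegaCategories : category :=
  @Category omega_cat omap oidm ocompm _ _ _.
Next Obligation. by move=> A B f; apply: omap_eq. Qed.
Next Obligation. by move=> A B f; apply: omap_eq. Qed.
Next Obligation. by move=> A B C D h g f; apply: omap_eq. Qed.

Program Definition forget_omega : functor OmegaCategories GSet :=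
  @Functor OmegaCategories GSet ogset (fun C D f => ogmap f) _ _.
Next Obligation. by move=> C; apply: gmap_eq. Qed.
Next Obligation. by move=> C D E g f; apply: gmap_eq. Qed.

(* Formal composites, not necessarily meaningful. *)
Inductive raw (A : gset) : nat -> Type :=
| Rgen k of A k : raw A k
| Rid k of raw A k : raw A k.+1
| Rcomp (j : nat) k of raw A k & raw A k : raw A k.
Arguments Rid {A k} _.

Section Free.
Context (A : gset).
Implicit Types C : omega_cat.

Fixpoint rsrc k (x : raw A k) : raw A k.-1 :=
  match x in raw _ k return raw A k.-1 with
  | Rgen k a =>
      match k return A k -> raw A k.-1 with
      | 0 => fun a => Rgen a
      | k'.+1 => fun a => Rgen (src a)
      end a
  | Rid k x => x
  | Rcomp j k x y =>
      if j == k.-1 then rsrc x else Rcomp j (rsrc x) (rsrc y)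
  end.

Fixpoint rtgt k (x : raw A k) : raw A k.-1 :=
  match x in raw _ k return raw A k.-1 with
  | Rgen k a =>
      match k return A k -> raw A k.-1 with
      | 0 => fun a => Rgen a
      | k'.+1 => fun a => Rgen (tgt a)
      end a
  | Rid k x => x
  | Rcomp j k x y =>
      if j == k.-1 then rtgt y else Rcomp j (rtgt x) (rtgt y)
  end.

(* The partial interpretation of formal composites along a globular map into a
   strict omega-category. *)
Fixpoint ev C (f : gmap A C) k (x : raw A k) : option (C k) :=
  match x in raw _ k return option (C k) with
  | Rgen k a => Some (f k a)
  | Rid k x => if ev f x is Some c then Some (oid c) else None
  | Rcomp j k x y =>
      match ev f x, ev f y with
      | Some c, Some d =>
          match excluded_middle_informative (composable j c d) with
          | left h => Some (ocomp h)
          | right _ => None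
          end
      | _, _ => None
      end
  end.

(* A formal composite is meaningful if it can be interpreted everywhere; two of
   them are identified if all their interpretations agree. Each class is
   represented by a chosen member. *)
Definition meaningful k (x : raw A k) : Prop :=
  forall C (f : gmap A C), exists c, ev f x = Some c.

Definition same k (x y : raw A k) : Prop :=
  forall C (f : gmap A C), ev f x = ev f y.

Definition canon k (x : raw A k) : raw A k := epsilon (inhabits x) (same x).

Lemma canon_same k (x : raw A k) : same x (canon x).
Proof. by apply: epsilon_spec; exists x. Qed.

Lemma same_canon k (x y : raw A k) : same x y -> canon x = canon y.
Proof.
move=> xy; rewrite /canon (proof_irrelevance _ (inhabits x) (inhabits y)).
congr epsilon; apply: functional_extensionality => z.
by apply: propositional_extensionality; split=> h C f; rewrite -h ?xy.
Qed.

Record free_cell k := FreeCell {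
  frep : raw A k;
  frep_meaningful : meaningful frep;
  frep_canon : canon frep = frep
}.

Program Definition fcls k (x : raw A k) (h : meaningful x) : free_cell k :=
  @FreeCell k (canon x) _ _.
Next Obligation. by move=> k x h C f; rewrite -(canon_same x). Qed.
Next Obligation. by move=> k x h; apply/esym/same_canon/canon_same. Qed.

Definition fev C (f : gmap A C) k (q : free_cell k) : C k :=
  sval (constructive_indefinite_description _ (frep_meaningful q f)).

Lemma fevP C (f : gmap A C) k (q : free_cell k) : ev f (frep q) = Some (fev f q).
Proof. by rewrite /fev; case: constructive_indefinite_description. Qed.

Lemma fev_cls C (f : gmap A C) k (x : raw A k) (h : meaningful x) :
  ev f x = Some (fev f (fcls h)).
Proof. by rewrite -fevP (canon_same x). Qed.

Lemma free_cell_ext k (q r : free_cell k) :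
  (forall C (f : gmap A C), fev f q = fev f r) -> q = r.
Proof.
move=> h; have e : frep q = frep r.
  rewrite -(frep_canon q) -(frep_canon r); apply: same_canon => C f.
  by rewrite !fevP h.
case: q r e {h} => [x hx cx] [y hy cy] /= e; subst y.
by congr FreeCell; apply: proof_irrelevance.
Qed.

Local Definition psrc (B : gset) k : B k -> B k.-1 :=
  match k with 0 => fun x => x | k'.+1 => fun x => src x end.

Local Definition ptgt (B : gset) k : B k -> B k.-1 :=
  match k with 0 => fun x => x | k'.+1 => fun x => tgt x end.

Lemma ev_rsrc C (f : gmap A C) k (x : raw A k) c :
  ev f x = Some c -> ev f (rsrc x) = Some (psrc c).
Proof.
elim: x c => {k} [k a | k x IH | j k x IHx y IHy] c /=.
- by case=> <- {c}; case: k a => //= k a; rewrite gmap_src.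
- by case: (ev f x) => // d [<-] /=; rewrite oid_src.
case: (ev f x) IHx => // cx /(_ _ erefl) IHx.
case: (ev f y) IHy => // cy /(_ _ erefl) IHy.
case: excluded_middle_informative => // h [<-] {c}.
case: k cx cy h x y IHx IHy => // k cx cy h x y IHx IHy.
rewrite [k.+1.-1]/=; case: eqP => [e | ne].
  by subst j; rewrite IHx /= ocomp_src_top.
have jk : j < k by move: (composable_lt h); rewrite ltnS leq_eqVlt => /orP[/eqP|].
rewrite /= IHx IHy /=; case: excluded_middle_informative => [h'|[]].
  by rewrite (ocomp_src h h').
exact: composable_src.
Qed.

Lemma ev_rtgt C (f : gmap A C) k (x : raw A k) c :
  ev f x = Some c -> ev f (rtgt x) = Some (ptgt c).
Proof.
elim: x c => {k} [k a | k x IH | j k x IHx y IHy] c /=.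
- by case=> <- {c}; case: k a => //= k a; rewrite gmap_tgt.
- by case: (ev f x) => // d [<-] /=; rewrite oid_tgt.
case: (ev f x) IHx => // cx /(_ _ erefl) IHx.
case: (ev f y) IHy => // cy /(_ _ erefl) IHy.
case: excluded_middle_informative => // h [<-] {c}.
case: k cx cy h x y IHx IHy => // k cx cy h x y IHx IHy.
rewrite [k.+1.-1]/=; case: eqP => [e | ne].
  by subst j; rewrite IHy /= ocomp_tgt_top.
have jk : j < k by move: (composable_lt h); rewrite ltnS leq_eqVlt => /orP[/eqP|].
rewrite /= IHx IHy /=; case: excluded_middle_informative => [h'|[]].
  by rewrite (ocomp_tgt h h').
exact: composable_tgt.
Qed.

Lemma meaningful_src k (q : free_cell k.+1) : meaningful (rsrc (frep q)).
Proof. by move=> C f; exists (src (fev f q)); rewrite (ev_rsrc (fevP f q)). Qed.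

Lemma meaningful_tgt k (q : free_cell k.+1) : meaningful (rtgt (frep q)).
Proof. by move=> C f; exists (tgt (fev f q)); rewrite (ev_rtgt (fevP f q)). Qed.

Definition fsrc k (q : free_cell k.+1) : free_cell k := fcls (meaningful_src q).
Definition ftgt k (q : free_cell k.+1) : free_cell k := fcls (meaningful_tgt q).

Lemma fev_src C (f : gmap A C) k (q : free_cell k.+1) :
  fev f (fsrc q) = src (fev f q).
Proof.
by apply: Some_inj; rewrite -fev_cls (ev_rsrc (fevP f q)).
Qed.

Lemma fev_tgt C (f : gmap A C) k (q : free_cell k.+1) :
  fev f (ftgt q) = tgt (fev f q).
Proof.
by apply: Some_inj; rewrite -fev_cls (ev_rtgt (fevP f q)).
Qed.

Program Definition free_gset : gset := @GSetObj free_cell fsrc ftgt _ _.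
Next Obligation.
by move=> k q; apply: free_cell_ext => C f; rewrite !(fev_src, fev_tgt) src_tgt.
Qed.
Next Obligation.
by move=> k q; apply: free_cell_ext => C f; rewrite !(fev_src, fev_tgt) tgt_src.
Qed.

Definition fevm C (f : gmap A C) : gmap free_gset C :=
  @GMap free_gset C (fev f) (fev_src f) (fev_tgt f).

Lemma meaningful_id k (q : free_cell k) : meaningful (Rid (frep q)).
Proof. by move=> C f; exists (oid (fev f q)) => /=; rewrite fevP. Qed.

Definition fid k (q : free_cell k) : free_cell k.+1 := fcls (meaningful_id q).

Lemma fev_id C (f : gmap A C) k (q : free_cell k) :
  fev f (fid q) = oid (fev f q).
Proof. by apply: Some_inj; rewrite -fev_cls /= fevP. Qed.

Lemma ev_comp C (f : gmap A C) j k (x y : raw A k) c d (h : composable j c d) :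
  ev f x = Some c -> ev f y = Some d -> ev f (Rcomp j x y) = Some (ocomp h).
Proof.
move=> /= -> ->; case: excluded_middle_informative => [h'|[]//].
by rewrite (proof_irrelevance _ h' h).
Qed.

Lemma meaningful_comp j k (q r : free_gset k) (h : composable j q r) :
  meaningful (Rcomp j (frep q) (frep r)).
Proof.
move=> C f; exists (ocomp (composable_map (fevm f) h)).
by apply: ev_comp; apply: fevP.
Qed.

Definition fcomp j k (q r : free_gset k) (h : composable j q r) : free_gset k :=
  fcls (meaningful_comp h).

Lemma fev_comp C (f : gmap A C) j k (q r : free_gset k) (h : composable j q r)
    (h' : composable j (fev f q) (fev f r)) :
  fev f (fcomp h) = ocomp h'.
Proof.
by apply: Some_inj; rewrite -fev_cls; apply: ev_comp; apply: fevP.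
Qed.

Lemma fev_id_src C (f : gmap A C) j k (q : free_gset k) :
  fev f (id_src (A := free_gset) fid j q) = id_src (@oid C) j (fev f q).
Proof.
elim: k q => //= k IH q; rewrite fev_id; congr oid.
by case: ifP => _; rewrite ?IH fev_src.
Qed.

Lemma fev_id_tgt C (f : gmap A C) j k (q : free_gset k) :
  fev f (id_tgt (A := free_gset) fid j q) = id_tgt (@oid C) j (fev f q).
Proof.
elim: k q => //= k IH q; rewrite fev_id; congr oid.
by case: ifP => _; rewrite ?IH fev_tgt.
Qed.

Local Notation cmap f h := (composable_map (fevm f) h).

Definition free_omega : omega_cat.
Proof.
apply: (@OmegaCat free_gset fid fcomp).
- by move=> k q; apply: free_cell_ext => C f; rewrite fev_src fev_id oid_src.
- by move=> k q; apply: free_cell_ext => C f; rewrite fev_tgt fev_id oid_tgt.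
- move=> k x y h; apply: free_cell_ext => C f.
  by rewrite !fev_src (fev_comp _ (cmap f h)) ocomp_src_top.
- move=> k x y h; apply: free_cell_ext => C f.
  by rewrite !fev_tgt (fev_comp _ (cmap f h)) ocomp_tgt_top.
- move=> j k x y h h' jk; apply: free_cell_ext => C f.
  have h2 := cmap f h'; rewrite fev_src (fev_comp _ (cmap f h)) (fev_comp _ h2).
  by move: h2; rewrite /= !fev_src => h2; apply: ocomp_src.
- move=> j k x y h h' jk; apply: free_cell_ext => C f.
  have h2 := cmap f h'; rewrite fev_tgt (fev_comp _ (cmap f h)) (fev_comp _ h2).
  by move: h2; rewrite /= !fev_tgt => h2; apply: ocomp_tgt.
- move=> j k x y z hxy hyz h1 h2; apply: free_cell_ext => C f.
  have e1 := cmap f h1; have e2 := cmap f h2.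
  rewrite (fev_comp _ e1) (fev_comp _ e2).
  move: e1 e2; rewrite /= (fev_comp _ (cmap f hxy)) (fev_comp _ (cmap f hyz)).
  by move=> e1 e2; apply: ocompA.
- move=> j k x h; apply: free_cell_ext => C f.
  have e := cmap f h; rewrite (fev_comp _ e).
  by move: e; rewrite /= fev_id_src => e; apply: ocomp_idl.
- move=> j k x h; apply: free_cell_ext => C f.
  have e := cmap f h; rewrite (fev_comp _ e).
  by move: e; rewrite /= fev_id_tgt => e; apply: ocomp_idr.
- move=> i j k x y x' y' hxy hxy' hx hy h1 h2 ij; apply: free_cell_ext => C f.
  have e1 := cmap f h1; have e2 := cmap f h2.
  rewrite (fev_comp _ e1) (fev_comp _ e2); move: e1 e2 => /=.
  rewrite (fev_comp _ (cmap f hxy)) (fev_comp _ (cmap f hxy')).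
  rewrite (fev_comp _ (cmap f hx)) (fev_comp _ (cmap f hy)).
  by move=> e1 e2; apply: ocomp_interchange.
- move=> j k x y h h'; apply: free_cell_ext => C f.
  have e := cmap f h'; rewrite fev_id (fev_comp _ (cmap f h)) (fev_comp _ e).
  by move: e; rewrite /= !fev_id => e; apply: oid_comp.
Defined.

Lemma meaningful_gen k (a : A k) : meaningful (Rgen a).
Proof. by move=> C f; exists (f k a). Qed.

Definition fgen k (a : A k) : free_omega k := fcls (meaningful_gen a).

Lemma fev_gen C (f : gmap A C) k (a : A k) : fev f (fgen a) = f k a.
Proof. by apply: Some_inj; rewrite -fev_cls. Qed.

Program Definition free_unit : gmap A free_omega := @GMap A free_omega fgen _ _.
Next Obligation.
by move=> k a; apply: free_cell_ext => C f; rewrite fev_src !fev_gen gmap_src.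
Qed.
Next Obligation.
by move=> k a; apply: free_cell_ext => C f; rewrite fev_tgt !fev_gen gmap_tgt.
Qed.

Definition free_lift C (f : gmap A C) : omap free_omega C.
Proof.
by apply: (@OMap free_omega C (fevm f)) => *; [apply: fev_id | apply: fev_comp].
Defined.

Lemma free_lift_unit C (f : gmap A C) : gcomp (free_lift f) free_unit = f.
Proof. by apply: gmap_eq => k x /=; rewrite fev_gen. Qed.

Lemma composable_ext j k (q r : free_gset k) :
  (forall C (f : gmap A C), composable j (fev f q) (fev f r)) ->
  composable j q r.
Proof.
elim: k q r => [q r /(_ free_omega free_unit) // | k IH q r] h /=.
move: h => /=; case: ifP => _ h; last first.
  by apply: IH => C f; rewrite fev_src fev_tgt; apply: h.
by apply: free_cell_ext => C f; rewrite fev_src fev_tgt; apply: h.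
Qed.

Lemma fcls_rep k (q : free_cell k) (h : meaningful (frep q)) : fcls h = q.
Proof.
by apply: free_cell_ext => C f; apply: Some_inj; rewrite -fev_cls fevP.
Qed.

Lemma free_lift_uniq C (g : omap free_omega C) :
  free_lift (gcomp g free_unit) = g.
Proof.
apply: omap_eq => k q; rewrite -(fcls_rep (frep_meaningful q)).
move: (frep q) (frep_meaningful q) => x hx; rewrite /=.
elim: x hx => {k q} [k a | k x IH | j k x IHx y IHy] hx.
- rewrite (proof_irrelevance _ hx (meaningful_gen a)).
  by rewrite -/(fgen a) fev_gen.
- have h : meaningful x.
    by move=> D f; case: (hx D f) => d /=; case: (ev f x) => // c _; exists c.
  have -> : fcls hx = fid (fcls h).
    apply: free_cell_ext => D f; rewrite fev_id; apply: Some_inj.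
    by rewrite -fev_cls /= (fev_cls f h).
  by rewrite fev_id IH; have /= <- := omap_id g (fcls h).
have hx1 : meaningful x.
  by move=> D f; case: (hx D f) => d /=; case: (ev f x) => // c _; exists c.
have hy1 : meaningful y.
  move=> D f; case: (hx D f) => d /=; case: (ev f x) => // e.
  by case: (ev f y) => // c _; exists c.
have hc (D : omega_cat) (f : gmap A D) : composable j (fev f (fcls hx1)) (fev f (fcls hy1)).
  case: (hx D f) => d /=; rewrite (fev_cls f hx1) (fev_cls f hy1).
  by case: excluded_middle_informative.
have h : composable (A := free_omega) j (fcls hx1) (fcls hy1).
  exact: composable_ext.
have -> : fcls hx = fcomp h.
  apply: free_cell_ext => D f; rewrite (fev_comp h (hc D f)); apply: Some_inj.
  by rewrite -fev_cls; apply: ev_comp; rewrite -fev_cls.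
rewrite (fev_comp h (hc _ _)).
have e := composable_map g h.
have /= -> := omap_comp h e.
by move: (hc _ _) e; rewrite IHx IHy => e1 e2; congr ocomp; apply: proof_irrelevance.
Qed.
End Free.

Definition free_omega_category : left_adjoint forget_omega :=
  @universal_left_adjoint OmegaCategories GSet forget_omega free_omega free_unit
    free_lift free_lift_unit free_lift_uniq.

Definition T : functor GSet GSet := functor_cmp forget_omega free_omega_category.

Definition eta (A : gset) : gmap A (T A) := lunit free_omega_category A.

Definition mu (A : gset) : gmap (T (T A)) (T A) :=
  fmap forget_omega
    (adj_counit (ladj_adj free_omega_category) (free_omega_category A)).

Notation Tmap f := (fmap T f : gmap (T _) (T _)).
Notation T1 := (T gone).

Lemma TmapM (A B C : gset) (g : gmap B C) (f : gmap A B) k (x : T A k) :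
  Tmap (gcomp g f) k x = Tmap g k (Tmap f k x).
Proof. exact: (f_equal (fun h : gmap _ _ => h k x) (fmapM T g f)). Qed.

Lemma Tmap1 (A : gset) k (x : T A k) : Tmap (gid A) k x = x.
Proof. exact: (f_equal (fun h : gmap _ _ => h k x) (fmap1 T A)). Qed.

Lemma Tmap_ext (A B : gset) (f g : gmap A B) k (x : T A k) :
  (forall m (a : A m), f m a = g m a) -> Tmap f k x = Tmap g k x.
Proof. by move=> /gmap_eq ->. Qed.

Lemma eta_nat (A B : gset) (f : gmap A B) k (x : A k) :
  eta B k (f k x) = Tmap f k (eta A k x).
Proof.
exact: (f_equal (fun h : gmap _ _ => h k x)
  (adj_unit_nat (ladj_adj free_omega_category) f)).
Qed.

Lemma mu_nat (A B : gset) (f : gmap A B) k (x : T (T A) k) :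
  Tmap f k (mu A k x) = mu B k (Tmap (fmap T f) k x).
Proof.
exact: (f_equal (fun h : omap _ _ => h k x)
  (adj_counit_nat (ladj_adj free_omega_category) (fmap free_omega_category f))).
Qed.

Lemma mu_eta (A : gset) k (x : T A k) : mu A k (eta (T A) k x) = x.
Proof.
exact: (f_equal (fun h : gmap _ _ => h k x)
  (adj_triangle_r (ladj_adj free_omega_category) (free_omega_category A))).
Qed.

Lemma mu_Teta (A : gset) k (x : T A k) : mu A k (Tmap (eta A) k x) = x.
Proof.
exact: (f_equal (fun h : omap _ _ => h k x)
  (adj_triangle_l (ladj_adj free_omega_category) A)).
Qed.

Lemma mu_mu (A : gset) k (x : T (T (T A)) k) :
  mu A k (Tmap (mu A) k x) = mu A k (mu (T A) k x).
Proof.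
exact/esym/(f_equal (fun h : omap _ _ => h k x)
  (adj_counit_nat (ladj_adj free_omega_category)
     (adj_counit (ladj_adj free_omega_category) (free_omega_category A)))).
Qed.

Arguments T : simpl never.
Arguments eta : simpl never.
Arguments mu : simpl never.
#[global] Opaque T eta mu.

(* The slice category of GSet over T1. *)
Record coll := CollObj {
  cells :> gset;
  arity : gmap cells T1
}.

Record coll_map (A B : coll) := CollMap {
  cmap :> gmap A B;
  cmap_arity : forall k (x : A k), arity B k (cmap k x) = arity A k x
}.

Lemma coll_map_eq (A B : coll) (f g : coll_map A B) :
  (forall k (x : A k), f k x = g k x) -> f = g.
Proof.
case: f g => [f fa] [g ga] /= /gmap_eq efg; subst g.
by congr CollMap; apply: proof_irrelevance.
Qed.

Definition coll_id (A : coll) : coll_map A A :=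
  @CollMap A A (gid A) (fun k x => erefl).

Program Definition coll_comp (A B C : coll) (g : coll_map B C)
    (f : coll_map A B) : coll_map A C := @CollMap A C (gcomp g f) _.
Next Obligation. by move=> A B C g f k x; rewrite /= !cmap_arity. Qed.

Program Definition Coll : category :=
  @Category coll coll_map coll_id coll_comp _ _ _.
Next Obligation. by move=> A B f; apply: coll_map_eq. Qed.
Next Obligation. by move=> A B f; apply: coll_map_eq. Qed.
Next Obligation. by move=> A B C D h g f; apply: coll_map_eq. Qed.

(* The k-cells of the tensor product: the pullback of arity A : A -> T1 along
   T! : T B -> T1. *)
Record tens_cell (A B : coll) (k : nat) := TensCell {
  tfst : A k;
  tsnd : T B k;
  tensP : arity A k tfst = Tmap (bang B) k tsnd
}.

Lemma tens_cell_eq (A B : coll) k (p q : tens_cell A B k) :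
  tfst p = tfst q -> tsnd p = tsnd q -> p = q.
Proof.
case: p q => [a x ax] [b y by'] /= e1 e2; subst b y.
by congr TensCell; apply: proof_irrelevance.
Qed.

Program Definition tens_gset (A B : coll) : gset :=
  @GSetObj (tens_cell A B)
    (fun k p => @TensCell A B k (src (tfst p)) (src (tsnd p)) _)
    (fun k p => @TensCell A B k (tgt (tfst p)) (tgt (tsnd p)) _) _ _.
Next Obligation. by move=> A B k p /=; rewrite !gmap_src tensP. Qed.
Next Obligation. by move=> A B k p /=; rewrite !gmap_tgt tensP. Qed.
Next Obligation. by move=> A B k p; apply: tens_cell_eq; apply: src_tgt. Qed.
Next Obligation. by move=> A B k p; apply: tens_cell_eq; apply: tgt_src. Qed.

Definition tens_fst (A B : coll) : gmap (tens_gset A B) A :=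
  @GMap (tens_gset A B) A (@tfst A B) (fun _ _ => erefl) (fun _ _ => erefl).

Definition tens_snd (A B : coll) : gmap (tens_gset A B) (T B) :=
  @GMap (tens_gset A B) (T B) (@tsnd A B) (fun _ _ => erefl) (fun _ _ => erefl).

Definition tens (A B : coll) : coll :=
  @CollObj (tens_gset A B)
    (gcomp (mu gone) (gcomp (Tmap (arity B)) (tens_snd A B))).

Lemma Tmap_bang (A B : gset) (f : gmap A B) k (x : T A k) :
  Tmap (bang B) k (Tmap f k x) = Tmap (bang A) k x.
Proof. by rewrite -TmapM; congr (Tmap _ k x); apply: gmap_eq. Qed.

Lemma Tmap_arity (A B : coll) (f : coll_map A B) k (x : T A k) :
  Tmap (arity B) k (Tmap f k x) = Tmap (arity A) k x.
Proof.
rewrite -TmapM; congr (Tmap _ k x).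
by apply: gmap_eq => m a /=; rewrite cmap_arity.
Qed.

Program Definition tens_map (A A' B B' : coll) (f : coll_map A A')
    (g : coll_map B B') : coll_map (tens A B) (tens A' B') :=
  @CollMap (tens A B) (tens A' B')
    (@GMap (tens A B) (tens A' B') (fun k p =>
       @TensCell A' B' k (f k (tfst p)) (Tmap g k (tsnd p)) _) _ _) _.
Next Obligation.
by move=> A A' B B' f g k p; rewrite Tmap_bang cmap_arity tensP.
Qed.
Next Obligation.
by move=> A A' B B' f g k p; apply: tens_cell_eq; rewrite /= gmap_src.
Qed.
Next Obligation.
by move=> A A' B B' f g k p; apply: tens_cell_eq; rewrite /= gmap_tgt.
Qed.
Next Obligation.
by move=> A A' B B' f g k p; rewrite /= Tmap_arity.
Qed.

Definition coll_unit : coll := @CollObj gone (eta gone).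

(* The data of a monoidal category, with only those directions of the
   constraint isomorphisms that enter the axioms of a monoid. *)
Record tensor_data (C : category) := TensorData {
  tprod : C -> C -> C;
  tprodm : forall A A' B B', hom A A' -> hom B B' ->
    hom (tprod A B) (tprod A' B');
  tprodm1 : forall A B, tprodm (idm A) (idm B) = idm (tprod A B);
  tprodmM : forall A A' A'' B B' B'' (f : hom A A') (f' : hom A' A'')
    (g : hom B B') (g' : hom B' B''),
    tprodm (f' ∘ f) (g' ∘ g) = tprodm f' g' ∘ tprodm f g;
  tunit : C;
  tassoc : forall A B D, hom (tprod A (tprod B D)) (tprod (tprod A B) D);
  tlunit : forall A, hom A (tprod tunit A);
  trunit : forall A, hom (tprod A tunit) A
}.
Arguments tprod {C} t _ _.
Arguments tprodm {C} t {A A' B B'} _ _.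
Arguments tunit {C} t.
Arguments tassoc {C} t A B D.
Arguments tlunit {C} t A.
Arguments trunit {C} t A.

Record monoid_on (C : category) (t : tensor_data C) (A : C) := MonoidOn {
  one : hom (tunit t) A;
  mul : hom (tprod t A A) A;
  mul_assoc : mul ∘ tprodm t (idm A) mul
            = mul ∘ tprodm t mul (idm A) ∘ tassoc t A A A;
  mul_one_l : mul ∘ tprodm t one (idm A) ∘ tlunit t A = idm A;
  mul_one_r : mul ∘ tprodm t (idm A) one = trunit t A
}.
Arguments one {C t A} _.
Arguments mul {C t A} _.

Lemma monoid_on_eq (C : category) (t : tensor_data C) (A : C)
  (s s' : monoid_on t A) : one s = one s' -> mul s = mul s' -> s = s'.
Proof.
case: s s' => [e m a l r] [e' m' a' l' r'] /= ee em; subst e' m'.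
by congr MonoidOn; apply: proof_irrelevance.
Qed.

Definition is_monoid_map (C : category) (t : tensor_data C) (A B : C)
    (sA : monoid_on t A) (sB : monoid_on t B) (f : hom A B) : Prop :=
  f ∘ one sA = one sB /\ f ∘ mul sA = mul sB ∘ tprodm t f f.

Lemma is_monoid_map_id (C : category) (t : tensor_data C) (A : C)
  (sA : monoid_on t A) : is_monoid_map sA sA (idm A).
Proof. by split; rewrite ?tprodm1 cmp1m ?cmpm1. Qed.

Lemma is_monoid_map_cmp (C : category) (t : tensor_data C) (A B D : C)
    (sA : monoid_on t A) (sB : monoid_on t B) (sD : monoid_on t D)
    (g : hom B D) (f : hom A B) :
  is_monoid_map sB sD g -> is_monoid_map sA sB f ->
  is_monoid_map sA sD (g ∘ f).
Proof.
move=> [g1 gM] [f1 fM]; split; first by rewrite -cmpA f1 g1.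
by rewrite -cmpA fM cmpA gM -cmpA -tprodmM.
Qed.

(* Objects and maps of a category D whose image under a functor to C carries,
   respectively preserves, a monoid structure. *)
Section MonoidsOver.
Context (C D : category) (t : tensor_data C) (F : functor D C).

Record monoid_over := MonoidOver {
  mcar :> D;
  mstr : monoid_on t (F mcar)
}.

Record monoid_over_map (A B : monoid_over) := MonoidOverMap {
  mmap :> hom A B;
  mmapP : is_monoid_map (mstr A) (mstr B) (fmap F mmap)
}.

Lemma monoid_over_map_eq (A B : monoid_over) (f g : monoid_over_map A B) :
  mmap f = mmap g -> f = g.
Proof.
case: f g => [f fP] [g gP] /= efg; subst g.
by congr MonoidOverMap; apply: proof_irrelevance.
Qed.

Program Definition monoids_over : category :=
  @Category monoid_over monoid_over_map
    (fun A => @MonoidOverMap A A (idm (mcar A)) _)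
    (fun A B E g f => @MonoidOverMap A E (mmap g ∘ mmap f) _) _ _ _.
Next Obligation. by move=> A; rewrite fmap1; apply: is_monoid_map_id. Qed.
Next Obligation.
by move=> A B E g f; rewrite fmapM; apply: is_monoid_map_cmp; apply: mmapP.
Qed.
Next Obligation. by move=> A B f; apply: monoid_over_map_eq; apply: cmp1m. Qed.
Next Obligation. by move=> A B f; apply: monoid_over_map_eq; apply: cmpm1. Qed.
Next Obligation. by move=> A B E E' h g f; apply: monoid_over_map_eq; apply: cmpA. Qed.

Definition monoids_over_forget : functor monoids_over D :=
  @Functor monoids_over D mcar mmap (fun _ => erefl) (fun _ _ _ _ _ => erefl).
End MonoidsOver.

Definition monoids (C : category) (t : tensor_data C) : category :=
  monoids_over t (functor_id C).

Program Definition monoids_over_part (C D : category) (t : tensor_data C)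
    (F : functor D C) : functor (monoids_over t F) (monoids t) :=
  @Functor (monoids_over t F) (monoids t)
    (fun A => @MonoidOver C C t (functor_id C) (F (mcar A)) (mstr A))
    (fun A B f => @MonoidOverMap C C t (functor_id C) _ _
                    (fmap F (mmap f)) (mmapP f)) _ _.
Next Obligation. by move=> C D t F A; apply: monoid_over_map_eq; apply: fmap1. Qed.
Next Obligation.
by move=> C D t F A B E g f; apply: monoid_over_map_eq; apply: fmapM.
Qed.

(* (a, w) |-> ((a, T fst w), mu (T snd w)); invertible because T is cartesian *)
Program Definition coll_assoc (A B D : coll) :
    coll_map (tens A (tens B D)) (tens (tens A B) D) :=
  @CollMap (tens A (tens B D)) (tens (tens A B) D)
    (@GMap (tens A (tens B D)) (tens (tens A B) D) (fun k p =>
       @TensCell (tens A B) D k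
         (@TensCell A B k (tfst p) (Tmap (tens_fst B D) k (tsnd p)) _)
         (mu D k (Tmap (tens_snd B D) k (tsnd p))) _) _ _) _.
Next Obligation. by move=> A B D k p; rewrite Tmap_bang tensP. Qed.
Next Obligation.
move=> A B D k p /=; rewrite mu_nat -!TmapM; congr (mu _ k (Tmap _ k _)).
by apply: gmap_eq => m q /=; rewrite tensP.
Qed.
Next Obligation.
move=> A B D k p; apply: tens_cell_eq; last by rewrite /= !gmap_src.
by apply: tens_cell_eq; rewrite //= gmap_src.
Qed.
Next Obligation.
move=> A B D k p; apply: tens_cell_eq; last by rewrite /= !gmap_tgt.
by apply: tens_cell_eq; rewrite //= gmap_tgt.
Qed.
Next Obligation. by move=> A B D k p; rewrite /= mu_nat !TmapM mu_mu. Qed.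

(* a |-> ( *, eta a); invertible because eta is cartesian *)
Program Definition coll_lunit (A : coll) : coll_map A (tens coll_unit A) :=
  @CollMap A (tens coll_unit A)
    (@GMap A (tens coll_unit A) (fun k a =>
       @TensCell coll_unit A k tt (eta A k a) _) _ _) _.
Next Obligation. by move=> A k a; rewrite -eta_nat. Qed.
Next Obligation. by move=> A k a; apply: tens_cell_eq; rewrite //= gmap_src. Qed.
Next Obligation. by move=> A k a; apply: tens_cell_eq; rewrite //= gmap_tgt. Qed.
Next Obligation. by move=> A k a; rewrite /= -eta_nat mu_eta. Qed.

(* (a, x) |-> a, which preserves arities as U lies over the unit *)
Program Definition tens_proj (A U : coll)
    (hU : forall k (u : U k), arity U k u = eta gone k tt) :
    coll_map (tens A U) A :=
  @CollMap (tens A U) A (tens_fst A U) _.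
Next Obligation.
move=> A U hU k p; rewrite /= tensP.
have -> : arity U = gcomp (eta gone) (bang U) by apply: gmap_eq => m u; apply: hU.
by rewrite TmapM mu_Teta.
Qed.

Program Definition Coll_tensor : tensor_data Coll :=
  @TensorData Coll tens tens_map _ _ coll_unit coll_assoc coll_lunit
    (fun A => @tens_proj A coll_unit _).
Next Obligation.
by move=> A B; apply: coll_map_eq => k p; apply: tens_cell_eq => //; apply: Tmap1.
Qed.
Next Obligation.
move=> A A' A'' B B' B'' f f' g g'; apply: coll_map_eq => k p.
by apply: tens_cell_eq => //; apply: TmapM.
Qed.
Next Obligation. by move=> A k []. Qed.

Definition Opd : category := monoids Coll_tensor.

Definition N : functor Opd Coll := monoids_over_forget Coll_tensor (functor_id Coll).

(* A k-collection, encoded as a collection without cells above dimension k. *)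
Record kcoll (k : nat) := KColl {
  kcar :> coll;
  kcarP : forall j, kcar j -> j <= k
}.

Definition KCollCat (k : nat) : category :=
  @Category (kcoll k) (fun A B => coll_map A B) (fun A => coll_id A)
    (fun A B D g f => coll_comp g f) (fun A B f => @cmp1m Coll A B f)
    (fun A B f => @cmpm1 Coll A B f) (fun A B D E h g f => @cmpA Coll A B D E h g f).

Record tr_cell (A : gset) (k j : nat) := TrCell {
  tval : A j;
  tle : j <= k
}.

Lemma tr_cell_eq (A : gset) k j (x y : tr_cell A k j) : tval x = tval y -> x = y.
Proof.
by case: x y => [x hx] [y hy] /= e; subst y; rewrite (bool_irrelevance hx hy).
Qed.

Program Definition tr_gset (k : nat) (A : gset) : gset :=
  @GSetObj (tr_cell A k)
    (fun j x => @TrCell A k j (src (tval x)) (ltnW (tle x)))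
    (fun j x => @TrCell A k j (tgt (tval x)) (ltnW (tle x))) _ _.
Next Obligation. by move=> k A j x; apply: tr_cell_eq; apply: src_tgt. Qed.
Next Obligation. by move=> k A j x; apply: tr_cell_eq; apply: tgt_src. Qed.

Definition tr_incl (k : nat) (A : gset) : gmap (tr_gset k A) A :=
  @GMap (tr_gset k A) A (@tval A k) (fun _ _ => erefl) (fun _ _ => erefl).

Definition tr_coll (k : nat) (A : coll) : kcoll k :=
  @KColl k (@CollObj (tr_gset k A) (gcomp (arity A) (tr_incl k A))) (@tle A k).

Program Definition tr_map (k : nat) (A B : coll) (f : coll_map A B) :
    coll_map (tr_coll k A) (tr_coll k B) :=
  @CollMap (tr_coll k A) (tr_coll k B)
    (@GMap (tr_coll k A) (tr_coll k B) (fun j x =>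
       @TrCell B k j (f j (tval x)) (tle x)) _ _) _.
Next Obligation. by move=> k A B f j x; apply: tr_cell_eq; apply: gmap_src. Qed.
Next Obligation. by move=> k A B f j x; apply: tr_cell_eq; apply: gmap_tgt. Qed.
Next Obligation. by move=> k A B f j x; apply: cmap_arity. Qed.

Program Definition truncation (k : nat) : functor Coll (KCollCat k) :=
  @Functor Coll (KCollCat k) (tr_coll k) (fun A B f => tr_map k f) _ _.
Next Obligation. by move=> k A; apply: coll_map_eq => j x; apply: tr_cell_eq. Qed.
Next Obligation.
by move=> k A B D g f; apply: coll_map_eq => j x; apply: tr_cell_eq.
Qed.

Definition ktens (k : nat) (A B : kcoll k) : kcoll k :=
  @KColl k (tens A B) (fun j p => kcarP (tfst p)).

Program Definition kcoll_lunit (k : nat) (A : kcoll k) :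
    coll_map A (tens (tr_coll k coll_unit) A) :=
  @CollMap A (tens (tr_coll k coll_unit) A)
    (@GMap A (tens (tr_coll k coll_unit) A) (fun j a =>
       @TensCell (tr_coll k coll_unit) A j
         (@TrCell gone k j tt (kcarP a)) (eta A j a) _) _ _) _.
Next Obligation. by move=> k A j a; rewrite -eta_nat. Qed.
Next Obligation.
move=> k A j a; apply: tens_cell_eq; last by rewrite /= gmap_src.
exact: tr_cell_eq.
Qed.
Next Obligation.
move=> k A j a; apply: tens_cell_eq; last by rewrite /= gmap_tgt.
exact: tr_cell_eq.
Qed.
Next Obligation. by move=> k A j a; rewrite /= -eta_nat mu_eta. Qed.

(* The truncated monoidal structure. As the j-cells of T A only depend on the
   cells of A of dimension at most j, the tensor product of collections
   without cells above k is the k-truncation of any tensor product extending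
   it. *)
Program Definition KColl_tensor (k : nat) : tensor_data (KCollCat k) :=
  @TensorData (KCollCat k) (@ktens k)
    (fun A A' B B' f g => tens_map f g) _ _ (tr_coll k coll_unit)
    (fun A B D => coll_assoc A B D) (@kcoll_lunit k)
    (fun A => @tens_proj A (tr_coll k coll_unit) _).
Next Obligation. by move=> k A B; apply: (@tprodm1 Coll Coll_tensor). Qed.
Next Obligation.
by move=> k A A' A'' B B' B'' f f' g g'; apply: (@tprodmM Coll Coll_tensor).
Qed.
Next Obligation. by move=> k A j [[]]. Qed.

Definition KOpd (k : nat) : category := monoids (KColl_tensor k).

Definition Opd_ (k : nat) : category :=
  monoids_over (KColl_tensor k) (truncation k).

Definition underlying_coll (k : nat) : functor (Opd_ k) Coll :=
  monoids_over_forget (KColl_tensor k) (truncation k).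

Definition underlying_kopd (k : nat) : functor (Opd_ k) (KOpd k) :=
  monoids_over_part (KColl_tensor k) (truncation k).

Lemma coll_assoc_nat (A A' B B' D D' : coll) (f : coll_map A A')
    (g : coll_map B B') (h : coll_map D D') k (p : tens A (tens B D) k) :
  coll_assoc A' B' D' k (tens_map f (tens_map g h) k p) =
  tens_map (tens_map f g) h k (coll_assoc A B D k p).
Proof.
apply: tens_cell_eq => /=; first apply: tens_cell_eq => //=.
  by rewrite -!TmapM; apply: Tmap_ext.
by rewrite mu_nat -!TmapM; congr (mu _ _ _); apply: Tmap_ext.
Qed.

(* A monoid structure on B, with unit object U, restricts to the k-truncation of
   A provided B lies between the latter and A. *)
Section Restriction.
Context (k : nat) (A B U : coll).
Context (v : coll_map B A) (i : coll_map (tr_coll k A) B).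
Context (v_inj : forall j (x y : B j), v j x = v j y -> x = y).
Context (vi : forall j (x : tr_coll k A j), v j (i j x) = tval x).
Context (iU : coll_map (tr_coll k coll_unit) U).
Context (e : coll_map U B) (m : coll_map (tens B B) B).
Context (m_assoc : forall j (p : tens B (tens B B) j),
  m j (tens_map (coll_id B) m j p) =
  m j (tens_map m (coll_id B) j (coll_assoc B B B j p))).
Context (m_one_l : forall j (u : U j) (b : B j) (p : tens B B j),
  tfst p = e j u -> tsnd p = eta B j b -> m j p = b).
Context (m_one_r : forall j (p : tens B U j),
  m j (tens_map (coll_id B) e j p) = tfst p).

Lemma incl_inj j (x y : tr_coll k A j) : i j x = i j y -> x = y.
Proof. by move=> xy; apply: tr_cell_eq; rewrite -!vi xy. Qed.

Program Definition restrict_map (X : kcoll k) (f : coll_map X B) :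
    coll_map X (tr_coll k A) :=
  @CollMap X (tr_coll k A)
    (@GMap X (tr_coll k A) (fun j x =>
       @TrCell A k j (v j (f j x)) (kcarP x)) _ _) _.
Next Obligation. by move=> X f j x; apply: tr_cell_eq; rewrite /= !gmap_src. Qed.
Next Obligation. by move=> X f j x; apply: tr_cell_eq; rewrite /= !gmap_tgt. Qed.
Next Obligation. by move=> X f j x; rewrite /= !cmap_arity. Qed.

Lemma restrict_mapK (X : kcoll k) (f : coll_map X B) j (x : X j) :
  i j (restrict_map f j x) = f j x.
Proof. by apply: v_inj; rewrite vi. Qed.

Definition restrict_one : coll_map (tr_coll k coll_unit) (tr_coll k A) :=
  @restrict_map (tr_coll k coll_unit) (coll_comp e iU).

Definition restrict_mul :
    coll_map (tens (tr_coll k A) (tr_coll k A)) (tr_coll k A) :=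
  @restrict_map (ktens (tr_coll k A) (tr_coll k A)) (coll_comp m (tens_map i i)).

Lemma restrict_mulK j p : i j (restrict_mul j p) = m j (tens_map i i j p).
Proof. exact: (@restrict_mapK (ktens (tr_coll k A) (tr_coll k A))). Qed.

Lemma restrict_oneK j p : i j (restrict_one j p) = e j (iU j p).
Proof. exact: (@restrict_mapK (tr_coll k coll_unit)). Qed.

Local Notation A' := (kcar (tr_coll k A)).

Lemma restrict_assoc j (p : tens A' (tens A' A') j) :
  restrict_mul j (tens_map (coll_id A') restrict_mul j p) =
  restrict_mul j (tens_map restrict_mul (coll_id A') j (coll_assoc A' A' A' j p)).
Proof.
apply: incl_inj; rewrite !restrict_mulK.
have -> : tens_map i i j (tens_map (coll_id A') restrict_mul j p) =
          tens_map (coll_id B) m j (tens_map i (tens_map i i) j p).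
  apply: tens_cell_eq; rewrite //= -!TmapM.
  by apply: Tmap_ext => n q; apply: restrict_mulK.
rewrite m_assoc coll_assoc_nat; congr (m _ _).
apply: tens_cell_eq; last by rewrite /= !Tmap1.
exact/esym/restrict_mulK.
Qed.

Lemma restrict_one_l j (x : A' j) :
  restrict_mul j (tens_map restrict_one (coll_id A') j (kcoll_lunit _ j x)) = x.
Proof.
apply: incl_inj; rewrite restrict_mulK.
apply: (@m_one_l j (iU j (@TrCell gone k j tt (tle x)))) => /=.
  exact: restrict_oneK.
by rewrite Tmap1 eta_nat.
Qed.

Lemma restrict_one_r j (p : tens A' (tr_coll k coll_unit) j) :
  restrict_mul j (tens_map (coll_id A') restrict_one j p) = tfst p.
Proof.
apply: incl_inj; rewrite restrict_mulK.
have -> : tens_map i i j (tens_map (coll_id A') restrict_one j p) =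
          tens_map (coll_id B) e j (tens_map i iU j p).
  apply: tens_cell_eq; rewrite //= -!TmapM.
  by apply: Tmap_ext => n q; apply: restrict_oneK.
by rewrite m_one_r.
Qed.

Definition restrict_monoid : monoid_on (KColl_tensor k) (tr_coll k A).
Proof.
apply: (@MonoidOn (KCollCat k) (KColl_tensor k) (tr_coll k A)
  restrict_one restrict_mul).
- by apply: coll_map_eq => j p; apply: restrict_assoc.
- by apply: coll_map_eq => j p; apply: restrict_one_l.
- by apply: coll_map_eq => j p; apply: restrict_one_r.
Defined.
End Restriction.

Section Pointwise.
Context (B : coll) (s : monoid_on Coll_tensor B).

Lemma opd_assoc j (p : tens B (tens B B) j) :
  mul s j (tens_map (coll_id B) (mul s) j p) =
  mul s j (tens_map (mul s) (coll_id B) j (coll_assoc B B B j p)).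
Proof. exact: (f_equal (fun h : coll_map _ _ => h j p) (mul_assoc s)). Qed.

Lemma opd_one_l j (u : coll_unit j) (b : B j) (p : tens B B j) :
  tfst p = one s j u -> tsnd p = eta B j b -> mul s j p = b.
Proof.
move=> pu pb.
have e := f_equal (fun h : coll_map _ _ => h j b) (mul_one_l s).
rewrite -[RHS]e; congr (mul s j _).
by apply: tens_cell_eq; rewrite /= ?Tmap1 // pu; case: u {pu}.
Qed.

Lemma opd_one_r j (p : tens B coll_unit j) :
  mul s j (tens_map (coll_id B) (one s) j p) = tfst p.
Proof. exact: (f_equal (fun h : coll_map _ _ => h j p) (mul_one_r s)). Qed.
End Pointwise.

Section KPointwise.
Context (k : nat) (B : kcoll k) (s : monoid_on (KColl_tensor k) B).

Lemma kopd_assoc j (p : tens B (tens B B) j) :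
  mul s j (tens_map (coll_id B) (mul s) j p) =
  mul s j (tens_map (mul s) (coll_id B) j (coll_assoc B B B j p)).
Proof. exact: (f_equal (fun h : coll_map _ _ => h j p) (mul_assoc s)). Qed.

Lemma kopd_one_l j (u : tr_coll k coll_unit j) (b : B j) (p : tens B B j) :
  tfst p = one s j u -> tsnd p = eta B j b -> mul s j p = b.
Proof.
move=> pu pb.
have e := f_equal (fun h : coll_map _ _ => h j b) (mul_one_l s).
rewrite -[RHS]e; congr (mul s j _).
apply: tens_cell_eq; rewrite /= ?Tmap1 // pu; congr (one s j _).
by apply: tr_cell_eq; case: (tval u).
Qed.

Lemma kopd_one_r j (p : tens B (tr_coll k coll_unit) j) :
  mul s j (tens_map (coll_id B) (one s) j p) = tfst p.
Proof. exact: (f_equal (fun h : coll_map _ _ => h j p) (mul_one_r s)). Qed.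
End KPointwise.

Definition tr_incl_coll (k : nat) (A : coll) : coll_map (tr_coll k A) A :=
  @CollMap (tr_coll k A) A (tr_incl k A) (fun _ _ => erefl).

Program Definition tr_incl_succ (k : nat) (A : coll) :
    coll_map (tr_coll k A) (tr_coll k.+1 A) :=
  @CollMap (tr_coll k A) (tr_coll k.+1 A)
    (@GMap (tr_coll k A) (tr_coll k.+1 A)
       (fun j x => @TrCell A k.+1 j (tval x) (leqW (tle x))) _ _)
    (fun _ _ => erefl).
Next Obligation. by move=> k A j x; apply: tr_cell_eq. Qed.
Next Obligation. by move=> k A j x; apply: tr_cell_eq. Qed.

Definition opd_restrict (k : nat) (A : coll) (s : monoid_on Coll_tensor A) :
    monoid_on (KColl_tensor k) (tr_coll k A) :=
  @restrict_monoid k A A coll_unit (coll_id A) (tr_incl_coll k A)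
    (fun _ _ _ h => h) (fun _ _ => erefl) (tr_incl_coll k coll_unit)
    (one s) (mul s) (@opd_assoc A s) (@opd_one_l A s) (@opd_one_r A s).

Definition kopd_restrict (k : nat) (A : coll)
    (s : monoid_on (KColl_tensor k.+1) (tr_coll k.+1 A)) :
    monoid_on (KColl_tensor k) (tr_coll k A) :=
  @restrict_monoid k A (tr_coll k.+1 A) (tr_coll k.+1 coll_unit)
    (tr_incl_coll k.+1 A) (tr_incl_succ k A)
    (fun j x y h => tr_cell_eq h) (fun _ _ => erefl) (tr_incl_succ k coll_unit)
    (one s) (mul s) (@kopd_assoc k.+1 _ s) (@kopd_one_l k.+1 _ s) (@kopd_one_r k.+1 _ s).

Lemma opd_restrict_map (k : nat) (A B : coll) (sA : monoid_on Coll_tensor A)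
    (sB : monoid_on Coll_tensor B) (f : coll_map A B) :
  is_monoid_map sA sB (f : hom (A : Coll) B) ->
  is_monoid_map (opd_restrict k sA) (opd_restrict k sB) (fmap (truncation k) f).
Proof.
move=> [f1 fM]; split; apply: coll_map_eq => j x; apply: tr_cell_eq.
  exact: (f_equal (fun h : coll_map _ _ => h j (tval x)) f1).
apply: etrans (f_equal (fun h : coll_map _ _ =>
  h j (tens_map (tr_incl_coll k A) (tr_incl_coll k A) j x)) fM) _.
apply: (f_equal (mul sB j)); apply: tens_cell_eq; rewrite //= -!TmapM.
exact: Tmap_ext.
Qed.

Lemma kopd_restrict_map (k : nat) (A B : coll)
    (sA : monoid_on (KColl_tensor k.+1) (tr_coll k.+1 A))
    (sB : monoid_on (KColl_tensor k.+1) (tr_coll k.+1 B)) (f : coll_map A B) :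
  is_monoid_map sA sB (fmap (truncation k.+1) f) ->
  is_monoid_map (kopd_restrict sA) (kopd_restrict sB) (fmap (truncation k) f).
Proof.
move=> [f1 fM]; split; apply: coll_map_eq => j x; apply: tr_cell_eq.
  exact: (f_equal (fun h : coll_map (tr_coll k.+1 coll_unit) (tr_coll k.+1 B) =>
    tval (h j (tr_incl_succ k coll_unit j x))) f1).
apply: etrans (f_equal (fun h : coll_map (tens (tr_coll k.+1 A) (tr_coll k.+1 A))
    (tr_coll k.+1 B) =>
  tval (h j (tens_map (tr_incl_succ k A) (tr_incl_succ k A) j x))) fM) _.
apply: (f_equal (fun p => tval (mul sB j p))); apply: tens_cell_eq.
  exact: tr_cell_eq.
rewrite /= -!TmapM.
by apply: Tmap_ext => n a; apply: tr_cell_eq.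
Qed.

Program Definition restriction (k : nat) : functor Opd (Opd_ k) :=
  @Functor Opd (Opd_ k)
    (fun P => @MonoidOver _ _ (KColl_tensor k) (truncation k) (mcar P)
                (opd_restrict k (mstr P)))
    (fun P Q f => @MonoidOverMap _ _ (KColl_tensor k) (truncation k) _ _ (mmap f)
                (opd_restrict_map k (mmapP f))) _ _.
Next Obligation. by move=> k P; apply: monoid_over_map_eq. Qed.
Next Obligation. by move=> k P Q R g f; apply: monoid_over_map_eq. Qed.

Program Definition N_succ (k : nat) : functor (Opd_ k.+1) (Opd_ k) :=
  @Functor (Opd_ k.+1) (Opd_ k)
    (fun P => @MonoidOver _ _ (KColl_tensor k) (truncation k) (mcar P)
                (kopd_restrict (mstr P)))
    (fun P Q f => @MonoidOverMap _ _ (KColl_tensor k) (truncation k) _ _ (mmap f)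
                (kopd_restrict_map (mmapP f))) _ _.
Next Obligation. by move=> k P; apply: monoid_over_map_eq. Qed.
Next Obligation. by move=> k P Q R g f; apply: monoid_over_map_eq. Qed.

(* The functors forgetting one dimension are compatible with the functors
   Opd -> Opd_k, so that N is N_0 N_1 ... N_k after Opd -> Opd_k. *)
Lemma N_succ_restriction (k : nat) (P : Opd) :
  N_succ k (restriction k.+1 P) = restriction k P.
Proof.
rewrite /=; congr MonoidOver.
apply: monoid_on_eq; apply: coll_map_eq => j x; apply: tr_cell_eq => //=.
apply: (f_equal (mul (mstr P) j)); apply: tens_cell_eq; rewrite //= -!TmapM.
exact: Tmap_ext.
Qed.

(* Opd_{k-1}, where Opd_{-1} = Coll *)
Definition Opd_pred (k : nat) : category :=
  match k with 0 => Coll | k'.+1 => Opd_ k' end.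

Definition N_ (k : nat) : functor (Opd_ k) (Opd_pred k) :=
  match k with 0 => underlying_coll 0 | k'.+1 => N_succ k' end.

Definition underlying_pred (k : nat) : functor (Opd_pred k) Coll :=
  match k with 0 => functor_id Coll | k'.+1 => underlying_coll k' end.

Section Chain.
Context (M_ : forall k, left_adjoint (N_ k)) (A : Coll).

Fixpoint M_chain (k : nat) : Opd_ k :=
  match k return Opd_ k with
  | 0 => M_ 0 A
  | k'.+1 => M_ k'.+1 (M_chain k')
  end.

(* The composite of the units A -> N_0 M_0 A -> N_0 N_1 M_1 M_0 A -> ..., all
   N_k being the identity on underlying collections. *)
Fixpoint M_chain_unit (k : nat) : hom A (underlying_coll k (M_chain k)) :=
  match k return hom A (underlying_coll k (M_chain k)) with
  | 0 => lunit (M_ 0) A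
  | k'.+1 =>
      fmap (underlying_coll k') (lunit (M_ k'.+1) (M_chain k')) ∘ M_chain_unit k'
  end.
End Chain.

Definition bijective_at (m : nat) (A B : Coll) (f : hom A B) : Prop :=
  bijective (fun x : cell (cells A) m => cmap f m x).

(* Main.v *)
From mathcomp Require Import all_boot.
Require Import Defs.
From Stdlib Require Import FunctionalExtensionality ProofIrrelevance.
From Stdlib Require Import ClassicalEpsilon PropExtensionality.

(** Truncation, from operads to [k]-operads, has a right adjoint, the coskeleton:
    it adds, above dimension [k], exactly one cell for each boundary and arity.
    A map from an operad [P] to the coskeleton of [Y] therefore amounts to a map
    of [k]-operads from the truncation of [P] to that of [Y] ([copd_ext],
    [copd_ext_opd], [copd_part]), and so every universal property of an operad
    descends to its truncation ([generates_low]). This carries all of the proof.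

    Let [X] be an object of [Opd_(k-1)] and let [L] be the operad through which
    the maps from [X] to operads that preserve the given [(k-1)]-operad structure
    factor universally ([free_over]). By the above, the [k]-truncation of [L] is
    universal among the [k]-operads over the [(k-1)]-operad [X]. Hence [M_k X]
    consists of the cells of [L] up to dimension [k] and of the cells of [X] above
    ([glue_coll], [M_exists], [M_uniq]). Above dimension [k] nothing has changed.
    Neither has it below, as the coskeleton of the [(k-1)]-operad [X] is an operad
    to which [L] maps, which gives an inverse of [X -> L] up to dimension [k-1]
    ([free_over_low_inverse]). For the last claim, composing the universal
    properties of the adjunctions shows that [M_k ... M_0 A] is universal among
    the objects of [Opd_k] under [A] ([chain_exists], [chain_uniq]), and [M A] is
    universal among operads; comparing both by means of coskeleta, the truncations
    of the two have the same universal property ([chain_iso]).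

    Two ingredients have to be constructed.

    The coskeleton is an operad because [T] is local: a [j]-cell of [T X] with
    [j <= k] is a [j]-cell of [T] of the [k]-truncation of [X] ([Tincl_inj],
    [Tincl_surj]). Every pasting diagram is built from cells of at most its own
    dimension, so that the point is injectivity: two low-dimensional diagrams that
    agree in the presence of the high cells of [X] agree without them. Again a
    coskeleton is responsible, this time of a strict omega-category [C]
    ([cosk_omega]): a map to [C] from the truncation of [X] extends to a map from
    [X] to the coskeleton of [C], which has the same low cells as [C].

    The operad [L] is built in two steps. The formal operadic composites of cells
    of [X] that make sense along every admissible map from [X] to an operad,
    identified when they have the same value along each such map, form an operad
    that maps to all others ([weak_opd], [weak_map_opd]); uniqueness of these maps
    is then forced by passing to the sub-operad generated by [X]
    ([gen_generates]). *)

Set Implicit Arguments.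
Unset Strict Implicit.
Unset Printing Implicit Defensive.

Local Open Scope cat_scope.
#[local] Obligation Tactic := idtac.

Local Notation is_opd_map := (is_monoid_map (t := Coll_tensor)).
Local Notation is_kopd_map k := (is_monoid_map (t := KColl_tensor k)).

(** * Categorical preliminaries *)

Lemma ladj_exists (C D : category) (G : functor C D) (F : left_adjoint G) (X : D) (Y : C)
    (f : hom X (G Y)) : exists g : hom (F X) Y, fmap G g ∘ lunit F X = f.
Proof.
exists (adj_counit (ladj_adj F) Y ∘ fmap F f).
by rewrite fmapM -cmpA -adj_unit_nat cmpA adj_triangle_r cmp1m.
Qed.

Lemma ladj_uniq (C D : category) (G : functor C D) (F : left_adjoint G) (X : D) (Y : C)
    (g g' : hom (F X) Y) : fmap G g ∘ lunit F X = fmap G g' ∘ lunit F X -> g = g'.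
Proof.
suff key (h : hom (F X) Y) :
    adj_counit (ladj_adj F) Y ∘ fmap F (fmap G h ∘ lunit F X) = h.
  by move=> e; rewrite -(key g) e key.
by rewrite fmapM cmpA -adj_counit_nat -cmpA adj_triangle_l cmpm1.
Qed.

Lemma is_monoid_map_inv (C : category) (t : tensor_data C) (A B : C)
    (sA : monoid_on t A) (sB : monoid_on t B) (f : hom A B) (g : hom B A) :
  f ∘ g = idm B -> g ∘ f = idm A -> is_monoid_map sA sB f -> is_monoid_map sB sA g.
Proof.
move=> fg gf [f1 fM]; split; first by rewrite -f1 cmpA gf cmp1m.
rewrite -[LHS]cmpm1 -tprodm1 -fg tprodmM cmpA -[g ∘ _ ∘ _]cmpA -fM.
by rewrite [g ∘ _]cmpA gf cmp1m.
Qed.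

Lemma inj_surj_bij (S U : Type) (f : S -> U) :
  injective f -> (forall y, exists x, f x = y) -> bijective f.
Proof.
move=> inj surj; pose g y := sval (constructive_indefinite_description _ (surj y)).
have fg : cancel g f by move=> y; rewrite /g; case: constructive_indefinite_description.
by exists g => // x; apply: inj.
Qed.

(** * The coskeleton of a globular set *)

Section IteratedBoundary.
Context (X : gset).

Definition face (b : bool) m (x : X m.+1) : X m := if b then tgt x else src x.

Lemma face_face b c m (x : X m.+2) : face b (face c x) = face b (src x).
Proof. by case: b c => [] [] //=; rewrite ?src_tgt ?tgt_src. Qed.

Lemma leq_cases m j : j <= m.+1 -> {m.+1 = j} + {j <= m}.
Proof.
by move=> h; case: (eqVneq m.+1 j) => [|ne]; [left | right;
  rewrite -ltnS ltn_neqAle eq_sym ne].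
Qed.

Lemma leq0_eq j : j <= 0 -> 0 = j.
Proof. by case: j. Qed.

(** The iterated source (for [b = false]) or target of [x] in dimension [j], which
    is [x] itself for [j = m]. *)
Fixpoint iface (b : bool) m : X m -> forall j, j <= m -> X j :=
  match m return X m -> forall j, j <= m -> X j with
  | 0 => fun x j h => ecast i (X i) (leq0_eq h) x
  | m'.+1 => fun x j h =>
      match leq_cases h with
      | left e => ecast i (X i) e x
      | right le => iface b (face b x) le
      end
  end.

Lemma iface_id b m (x : X m) h : iface b x h = x.
Proof.
case: m x h => [|m] x h /=; first by rewrite (eq_irrelevance (leq0_eq h) erefl).
case: leq_cases => [e | le]; first by rewrite (eq_irrelevance e erefl).
by exfalso; rewrite ltnn in le.
Qed.

Lemma ifaceS b m (x : X m.+1) j (h : j <= m.+1) (h' : j <= m) :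
  iface b x h = iface b (face b x) h'.
Proof.
rewrite /=; case: leq_cases => [e | le]; first by exfalso; rewrite -e ltnn in h'.
by rewrite (bool_irrelevance le h').
Qed.

Arguments iface : simpl never.

(** By globularity, the iterated boundary of a cell in dimension [j] only depends on
    its last step, so that one may start with either face as long as [j < m]. *)
Lemma iface_face b c m (x : X m.+1) j (h' : j <= m) : j < m ->
  iface b (face c x) h' = iface b (src x) h'.
Proof.
case: m x h' => // m x h'; rewrite ltnS => jm.
by rewrite !(ifaceS _ _ _ jm) face_face.
Qed.

Lemma face_iface c b m (x : X m) j (h : j < m) (h' : j <= m) :
  face c (iface b x h) = iface c x h'.
Proof.
elim: m x h h' => // m IH x h h'.
case: (leq_cases h) => [[e] | jm].
  by subst j; rewrite iface_id (ifaceS _ _ _ (leqnn m)) iface_id.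
rewrite (ifaceS _ _ _ jm) (IH _ _ (ltnW jm)) (ifaceS _ _ _ (ltnW jm)).
by rewrite !iface_face.
Qed.
End IteratedBoundary.

Arguments iface : simpl never.

Lemma iface_map (X Y : gset) (f : gmap X Y) b m (x : X m) j (h : j <= m) :
  f j (iface b x h) = iface b (f m x) h.
Proof.
elim: m x h => [|m IH] x h.
  by have e := leq0_eq h; subst j; rewrite !iface_id.
case: (leq_cases h) => [e | jm]; first by subst j; rewrite !iface_id.
rewrite !(ifaceS _ _ _ jm) IH; congr (iface b _ jm).
by rewrite /face; case: ifP => _; rewrite /= ?gmap_src ?gmap_tgt.
Qed.

Lemma gmap_face (X Y : gset) (f : gmap X Y) b m (x : X m.+1) :
  f m (face b x) = face b (f m.+1 x).
Proof. by case: b; rewrite /= ?gmap_src ?gmap_tgt. Qed.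

Lemma tval_face k (X : gset) b m (x : tr_gset k X m.+1) : tval (face b x) =
  face b (tval x).
Proof. by case: b. Qed.

Section Coskeleton.
Context (k : nat).

(** The dimensions in which an [m]-cell has a boundary that the [k]-truncation
    retains; [m] itself is included, where the boundary is the cell. *)
Definition low m j : bool := (j <= k) && (j <= m).

Lemma low_k m j : low m j -> j <= k. Proof. by case/andP. Qed.
Lemma low_m m j : low m j -> j <= m. Proof. by case/andP. Qed.
Lemma lowS m j : low m j -> low m.+1 j.
Proof. by case/andP=> ? ?; rewrite /low leqW ?andbT. Qed.
Lemma low_pred m j : low m j.+1 -> low m j.
Proof. by case/andP=> a b; apply/andP; split; apply: ltnW. Qed.
Lemma lowSS m j : low m.+1 j.+1 -> low m j.
Proof. by case/andP=> a b; apply/andP; split=> //; apply: ltnW. Qed.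
Lemma low_refl m : m <= k -> low m m.
Proof. by move=> h; rewrite /low h leqnn. Qed.

Section Cosk.
Context (C : gset).

(** A globular map to [C] from the [k]-truncation of the [m]-globe: [bval x h b] is
    the [j]-dimensional source or target of [x]. The truncated globe has only one
    cell in dimension [m], whence [bval_top]. For [m > k] such a map is a parallel
    pair of [k]-cells together with its boundary. *)
Record cosk_cell m := CoskCell {
  bval : forall j, low m j -> bool -> C j;
  bval_top : forall h, @bval m h true = @bval m h false;
  bval_face : forall c j (h : low m j.+1) b, face c (@bval j.+1 h b) =
    @bval j (low_pred h) c
}.

Lemma bval_irr m (x : cosk_cell m) j (h h' : low m j) b : bval x h b = bval x h' b.
Proof. by rewrite (bool_irrelevance h h'). Qed.

Lemma bval_faceE c m (x : cosk_cell m) j (h : low m j.+1) (h' : low m j) b :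
  face c (bval x h b) = bval x h' c.
Proof. by rewrite bval_face; apply: bval_irr. Qed.

Lemma cosk_cell_eq m (x y : cosk_cell m) :
  (forall j (h : low m j) b, bval x h b = bval y h b) -> x = y.
Proof.
case: x y => [x xt xb] [y yt yb] /= e.
have exy : x = y.
  apply: functional_extensionality_dep => j.
  apply: functional_extensionality => h; apply: functional_extensionality => b; exact: e.
by subst y; congr CoskCell; apply: proof_irrelevance.
Qed.

Lemma bval_topE m (x : cosk_cell m) j (h h' : low m j) b c :
  j = m -> bval x h b = bval x h' c.
Proof.
by move=> e; subst j; rewrite (bval_irr x h' h); have := bval_top x h; case: b c => [] [].
Qed.

Program Definition cosk_src m (x : cosk_cell m.+1) : cosk_cell m :=
  @CoskCell m (fun j h b => bval x (lowS h) (b && (j < m))) _ _.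
Next Obligation. by move=> m x h /=; rewrite ltnn. Qed.
Next Obligation.
move=> m x c j h b /=; rewrite (bval_faceE _ _ _ (lowS (low_pred h))).
by rewrite (low_m h) andbT.
Qed.

Program Definition cosk_tgt m (x : cosk_cell m.+1) : cosk_cell m :=
  @CoskCell m (fun j h b => bval x (lowS h) (b || (j == m))) _ _.
Next Obligation. by move=> m x h /=; rewrite eqxx. Qed.
Next Obligation.
move=> m x c j h b /=; rewrite (bval_faceE _ _ _ (lowS (low_pred h))).
by rewrite (ltn_eqF (low_m h)) orbF.
Qed.

Program Definition cosk_gset : gset := @GSetObj cosk_cell cosk_src cosk_tgt _ _.
Next Obligation.
move=> m x; apply: cosk_cell_eq => j h b; have jm : j < m.+1 := low_m h.
by rewrite /= jm (ltn_eqF jm) orbF andbT.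
Qed.
Next Obligation.
move=> m x; apply: cosk_cell_eq => j h b; have jm : j < m.+1 := low_m h.
by rewrite /= jm (ltn_eqF jm) orbF andbT.
Qed.

(** A face has the boundary of the cell, except in its own dimension, where it is
    the chosen side of that boundary. *)
Lemma bval_of_face c m (x : cosk_gset m.+1) j (h : low m j) b :
  bval (face c x) h b = bval x (lowS h) (if j < m then b else c).
Proof.
case: c => /=; have := low_m h; rewrite leq_eqVlt => /orP[/eqP e | jm].
- by subst j; rewrite eqxx orbT ltnn.
- by rewrite (ltn_eqF jm) jm orbF.
- by subst j; rewrite ltnn andbF.
- by rewrite jm andbT.
Qed.

(** Up to dimension [k] a cell of the coskeleton is given by its top component. *)
Program Definition cosk_low : gmap (tr_gset k cosk_gset) C :=
  @GMap (tr_gset k cosk_gset) C (fun j x => bval (tval x) (low_refl (tle x)) false) _ _.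
Next Obligation.
move=> j x /=; rewrite -[RHS]/(face false _) (bval_faceE _ _ _
  (lowS (low_refl (ltnW (tle x))))).
exact: bval_irr.
Qed.
Next Obligation.
move=> j x /=; rewrite -[RHS]/(face true _) (bval_faceE _ _ _
  (lowS (low_refl (ltnW (tle x))))).
by rewrite eqxx; apply: bval_irr.
Qed.

(** All components of a cell are determined by its low boundary, which makes the
    coskeleton cofree over the truncation: see [cosk_map_ext] and [cosk_ext]. *)
Lemma bval_iface m (x : cosk_gset m) j (h : low m j) b :
  bval x h b = cosk_low j (@TrCell cosk_gset k j (iface b x (low_m h)) (low_k h)).
Proof.
elim: m x h => [|m IH] x h.
  have e : j = 0 by apply/eqP; rewrite -leqn0 (low_m h).
  by subst j; rewrite /= iface_id; apply: bval_topE.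
case: (leq_cases (low_m h)) => [e | jm].
  by subst j; rewrite /= (iface_id b x); apply: bval_topE.
have h' : low m j by rewrite /low (low_k h).
rewrite (_ : TrCell _ _ = TrCell (iface b (face b x) (low_m h')) (low_k h')).
  by rewrite -IH bval_of_face if_same; apply: bval_irr.
by apply: tr_cell_eq; apply: ifaceS.
Qed.

Lemma bval_iface_top m (x : cosk_gset m) (hm : m <= k) j (h : low m j) b :
  bval x h b = iface b (bval x (low_refl hm) false) (low_m h).
Proof.
rewrite bval_iface.
have -> : TrCell (iface b x (low_m h)) (low_k h) =
          iface b (@TrCell cosk_gset k m x hm : tr_gset k cosk_gset m) (low_m h).
  by apply: tr_cell_eq; rewrite -[RHS]/(tr_incl k cosk_gset j _) iface_map.
by rewrite iface_map.
Qed.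

(** This and the next lemma describe the cells: up to dimension [k] they are cells
    of [C], and above they are determined by their faces. *)
Lemma cosk_eq_top m (x y : cosk_gset m) (h : low m m) :
  bval x h false = bval y h false -> x = y.
Proof.
move=> e; apply: cosk_cell_eq => j l b; rewrite (bval_iface_top x (low_k h))
  (bval_iface_top y (low_k h)).
by rewrite (bval_irr x _ h) (bval_irr y _ h) e.
Qed.

Lemma cosk_eq_face m (x y : cosk_gset m.+1) : k <= m ->
  (forall c, face c x = face c y) -> x = y.
Proof.
move=> km e; apply: cosk_cell_eq => j h b.
have l : low m j by rewrite /low (low_k h) (leq_trans (low_k h)).
have := f_equal (fun z : cosk_gset m => bval z l b) (e b).
by rewrite !bval_of_face if_same !(bval_irr _ (lowS l) h).
Qed.

Context (X : gset).

Lemma cosk_map_ext (f g : gmap X cosk_gset) :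
  (forall j (x : X j) (h : j <= k),
     cosk_low j (@TrCell cosk_gset k j (f j x) h) =
     cosk_low j (@TrCell cosk_gset k j (g j x) h)) -> f = g.
Proof.
move=> e; apply: gmap_eq => m x; apply: cosk_cell_eq => j h b.
by rewrite !bval_iface -!iface_map e.
Qed.

Context (g : gmap (tr_gset k X) C).

Program Definition cosk_ext_cell m (x : X m) : cosk_cell m :=
  @CoskCell m (fun j h b => g j (@TrCell X k j (iface b x (low_m h)) (low_k h))) _ _.
Next Obligation.
by move=> m x h; congr (g _ _); apply: tr_cell_eq; rewrite /= !iface_id.
Qed.
Next Obligation.
move=> m x c j h b; rewrite -gmap_face; congr (g _ _); apply: tr_cell_eq.
by rewrite tval_face /= (face_iface c _ _ _ (low_m (low_pred h))).
Qed.

Lemma cosk_ext_face c m (x : X m.+1) :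
  cosk_ext_cell (face c x) = face c (cosk_ext_cell x : cosk_gset m.+1).
Proof.
apply: cosk_cell_eq => j h b; rewrite bval_of_face /=; congr (g _ _);
  apply: tr_cell_eq => /=.
have := low_m h; rewrite leq_eqVlt => /orP[/eqP e | jm].
  by subst j; rewrite ltnn iface_id (ifaceS _ _ _ (leqnn m)) iface_id.
by rewrite jm (ifaceS _ _ _ (low_m h)) !iface_face.
Qed.

Definition cosk_ext : gmap X cosk_gset :=
  @GMap X cosk_gset cosk_ext_cell (cosk_ext_face false) (cosk_ext_face true).

Lemma cosk_extK j (x : X j) (h : j <= k) :
  cosk_low j (@TrCell cosk_gset k j (cosk_ext j x) h) = g j (@TrCell X k j x h).
Proof. by rewrite /=; congr (g _ _); apply: tr_cell_eq; rewrite /= iface_id. Qed.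
End Cosk.
End Coskeleton.

(** * The coskeleton of a strict omega-category *)

Lemma composable_face (C : gset) b i j (x y : C j.+1) : i < j -> composable i x y ->
  composable i (face b x) (face b y).
Proof. by case: b; [apply: composable_tgt | apply: composable_src]. Qed.

Section TotalComposition.
Context (C : omega_cat).

(** Composition made total, with a junk value, so that equations between
    composites can be rewritten without transporting proofs of composability. *)
Definition tcomp i j (x y : C j) : C j :=
  if excluded_middle_informative (composable i x y) is left h then ocomp h else x.

Lemma tcompE i j (x y : C j) (h : composable i x y) : ocomp h = tcomp i x y.
Proof.
rewrite /tcomp; case: excluded_middle_informative => // h'.
by rewrite (proof_irrelevance _ h h').
Qed.

Lemma face_tcomp_top b j (x y : C j.+1) : composable j x y ->
  face b (tcomp j x y) = face b (if b then y else x).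
Proof.
by move=> h; rewrite -(tcompE h); case: b; rewrite /= ?ocomp_tgt_top ?ocomp_src_top.
Qed.

Lemma face_tcomp b i j (x y : C j.+1) : i < j -> composable i x y ->
  face b (tcomp i x y) = tcomp i (face b x) (face b y).
Proof.
move=> ij h; have h' := composable_face b ij h.
rewrite -(tcompE h) -(tcompE h'); case: b h' => h' /=.
  by rewrite (ocomp_tgt h h').
by rewrite (ocomp_src h h').
Qed.

Lemma face_oid b j (x : C j) : face b (oid x) = x.
Proof. by case: b; rewrite /= ?oid_tgt ?oid_src. Qed.
End TotalComposition.

Definition id_face (X : gset) (o : forall j, X j -> X j.+1) (s : bool) i j (x : X j) :=
  if s then id_tgt o i x else id_src o i x.

Lemma id_faceS (X : gset) (o : forall j, X j -> X j.+1) s i j (x : X j.+1) :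
  id_face o s i x = o j (if i == j then face s x else id_face o s i (face s x)).
Proof. by case: s. Qed.

(** The operations of the coskeleton are those of [C] in each component, apart from
    the components in which a boundary is selected; each axiom then holds because it
    holds in [C] for the components in which the operations of [C] are applied. *)
Section CoskOmega.
Context (k : nat) (C : omega_cat).
Local Notation low := (low k).
Local Notation K := (cosk_gset k C).
Local Notation cosk_cell := (cosk_cell k C).

Lemma low_top m : low m m.+1 = false.
Proof. by rewrite /low ltnn andbF. Qed.

Lemma low_cases m j : low m.+1 j -> {low m j} + {m.+1 = j}.
Proof.
move=> h; case: (leq_cases (low_m h)) => [|jm]; [by right | left].
by rewrite /low (low_k h).
Qed.

(** The identity of an [m]-cell has one more component, in dimension [m.+1], unless
    [m.+1 > k]: then it has the same components as the cell. *)
Definition cosk_id_fun m (x : cosk_cell m) j (h : low m.+1 j) (b : bool) : C j.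
refine (match low_cases h with
| left h' => bval x h' b
| right e => ecast j (C j) e (oid (bval x (_ : low m m) b))
end).
by rewrite -e in h; apply: lowSS h.
Defined.

Lemma cosk_id_fun_low m (x : cosk_cell m) j (h : low m.+1 j) (h' : low m j) b :
  cosk_id_fun x h b = bval x h' b.
Proof.
rewrite /cosk_id_fun; case: low_cases => [h2|e]; first exact: bval_irr.
by exfalso; subst j; rewrite low_top in h'.
Qed.

Lemma cosk_id_fun_top m (x : cosk_cell m) (h : low m.+1 m.+1) (h' : low m m) b c :
  cosk_id_fun x h b = oid (bval x h' c).
Proof.
rewrite /cosk_id_fun; case: low_cases => [h2|e]; first by exfalso; rewrite low_top in h2.
by rewrite (eq_irrelevance e erefl) /=; congr oid; apply: bval_topE.
Qed.

Program Definition cosk_id m (x : K m) : K m.+1 := @CoskCell k C m.+1 (cosk_id_fun x) _ _.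
Next Obligation.
by move=> m x h; rewrite !(@cosk_id_fun_top _ _ _ (lowSS h) _ false).
Qed.
Next Obligation.
move=> m x c j h b; case: (low_cases h) => [h' | [e]].
  by rewrite (cosk_id_fun_low x h h') (cosk_id_fun_low x _ (low_pred h')) bval_face.
subst j; rewrite (@cosk_id_fun_top _ _ _ (lowSS h) _ c) face_oid.
by rewrite (cosk_id_fun_low x _ (lowSS h)).
Qed.

Lemma cosk_idE m (x : K m) j (h : low m.+1 j) (h' : low m j) b :
  bval (cosk_id x) h b = bval x h' b.
Proof. exact: cosk_id_fun_low. Qed.

Lemma cosk_id_topE m (x : K m) (h : low m.+1 m.+1) (h' : low m m) b c :
  bval (cosk_id x) h b = oid (bval x h' c).
Proof. exact: cosk_id_fun_top. Qed.

Lemma face_cosk_id c m (x : K m) : face c (cosk_id x) = x.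
Proof.
apply: cosk_cell_eq => j h b; rewrite bval_of_face (cosk_idE _ _ h).
by case: ltnP => // mj; apply: bval_topE; apply/eqP; rewrite eqn_leq mj (low_m h).
Qed.

(** Cells that are composable along dimension [i] have the same boundary below [i] and,
    by the next lemma, a matching target and source in dimension [i]. For [i > k] they
    are thus equal, and so is their composite. *)
Lemma cosk_composable_below i m (x y : K m) : composable i x y ->
  forall j (h : low m j) b, j < i -> bval x h b = bval y h b.
Proof.
elim: m x y => // m IH x y /= cxy j h b ji.
have im : i <= m by apply: (@composable_lt _ _ m.+1 x y cxy).
have jm := leq_trans ji im.
have h' : low m j by rewrite /low (low_k h) ltnW.
move: cxy; case: eqP => [e | ne] c.
  have := f_equal (fun z : cosk_cell m => bval z h' b) c.
  by rewrite (bval_of_face true) (bval_of_face false) jm !(bval_irr _ (lowS h') h).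
have := IH _ _ c j h' b ji.
by rewrite (bval_of_face true) (bval_of_face false) jm !(bval_irr _ (lowS h') h).
Qed.

Lemma cosk_composable_at i m (x y : K m) : composable i x y ->
  forall (h : low m i), bval x h true = bval y h false.
Proof.
elim: m x y => // m IH x y; rewrite /=; case: eqP => [e | ne] c h.
  subst i; have h' : low m m by apply: low_refl (low_k h).
  have := f_equal (fun z : cosk_cell m => bval z h' false) c.
  by rewrite (bval_of_face true) (bval_of_face false) ltnn !(bval_irr _ (lowS h') h).
have im := composable_lt c.
have h' : low m i by rewrite /low (low_k h) ltnW.
have := IH _ _ c h'.
by rewrite (bval_of_face true) (bval_of_face false) im !(bval_irr _ (lowS h') h).
Qed.

(** The [i]-dimensional boundaries of components above [i] are components, so these
    can be composed in [C]. *)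
Lemma cosk_composable_above i m (x y : K m) : composable i x y ->
  forall j (h : low m j) b c, i < j -> composable i (bval x h b) (bval y h c).
Proof.
move=> cxy; elim=> // j IH h b c; rewrite ltnS leq_eqVlt => /orP[/eqP e|ij].
  subst j; rewrite /= eqxx -[LHS]/(face true _) -[RHS]/(face false _) !bval_face.
  exact: cosk_composable_at.
rewrite /= (ltn_eqF ij) -/(face true (bval x h b)) -/(face false (bval y h c)) !bval_face.
exact: IH.
Qed.

Definition cosk_comp_fun i m (x y : cosk_cell m) j (h : low m j) (b : bool) : C j :=
  if j < i then bval x h b
  else if j == i then (if b then bval y h b else bval x h b)
  else tcomp i (bval x h b) (bval y h b).

Program Definition cosk_comp i m (x y : K m) (c : composable i x y) : K m :=
  @CoskCell k C m (cosk_comp_fun i x y) _ _.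
Next Obligation.
move=> i m x y c h; have im := composable_lt c.
by rewrite /cosk_comp_fun ltnNge (ltnW im) (gtn_eqF im) !bval_top.
Qed.
Next Obligation.
move=> i m x y cxy c j h b; rewrite /cosk_comp_fun.
case: (ltngtP j.+1 i) => [ji | ij | e].
- by rewrite bval_face.
- move: (ij); rewrite ltnS leq_eqVlt => /orP[/eqP e | ij'].
    subst i; rewrite eqxx face_tcomp_top; last exact: (cosk_composable_above cxy).
    by case: (c); rewrite bval_face.
  rewrite (gtn_eqF ij') face_tcomp ?bval_face //.
  exact: (cosk_composable_above cxy).
by case: b; rewrite !bval_face // (cosk_composable_below cxy) // -e.
Qed.

Lemma bval_comp i m (x y : K m) (c : composable i x y) j (h : low m j) b :
  bval (cosk_comp c) h b = if j < i then bval x h b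
  else if j == i then (if b then bval y h b else bval x h b)
  else tcomp i (bval x h b) (bval y h b).
Proof. by []. Qed.

Lemma face_cosk_comp_top c m (x y : K m.+1) (h : composable m x y) :
  face c (cosk_comp h) = face c (if c then y else x).
Proof.
apply: cosk_cell_eq => j l b; rewrite !bval_of_face bval_comp.
have := low_m l; rewrite leq_eqVlt => /orP[/eqP e | jm].
  by subst j; rewrite ltnn eqxx; case: c.
by rewrite jm; case: c => //; apply: (cosk_composable_below h).
Qed.

Lemma face_cosk_comp c i m (x y : K m.+1) (h : composable i x y)
    (h' : composable i (face c x) (face c y)) : i < m -> face c (cosk_comp h) =
      cosk_comp h'.
Proof.
move=> im; apply: cosk_cell_eq => j l b; rewrite bval_of_face !bval_comp !bval_of_face.
by case: ltngtP => // e; subst j; rewrite im; case: b.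
Qed.

Lemma cosk_compA i m (x y z : K m) (hxy : composable i x y)
    (hyz : composable i y z) (h1 : composable i (cosk_comp hxy) z)
    (h2 : composable i x (cosk_comp hyz)) : cosk_comp h1 = cosk_comp h2.
Proof.
apply: cosk_cell_eq => j l b; rewrite !bval_comp; case: ltngtP => // [ij|e];
  last by case: b.
have cxy := cosk_composable_above hxy l b b ij.
have cyz := cosk_composable_above hyz l b b ij.
have := cosk_composable_above h1 l b b ij; have := cosk_composable_above h2 l b b ij.
rewrite !bval_comp ltnNge (ltnW ij) (gtn_eqF ij) /=.
rewrite -(tcompE cxy) -(tcompE cyz) => c2 c1.
by rewrite -(tcompE c1) -(tcompE c2); apply: ocompA.
Qed.

(** Both components of [x] in dimension [j] have the same boundary below [j]. *)
Lemma id_face_bval s i m (x : K m) j (h : low m j) b c : i < j ->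
  id_face (@oid C) s i (bval x h b) = id_face (@oid C) s i (bval x h c).
Proof. by case: j h => // j h ij; rewrite !id_faceS !bval_face. Qed.

Lemma bval_id_face s i m (x : K m) j (h : low m j) b : i < m ->
  bval (id_face cosk_id s i x) h b =
  if j < i then bval x h b else if j == i then bval x h s
  else id_face (@oid C) s i (bval x h b).
Proof.
elim: m x j h b => // m IH x j h b im; rewrite id_faceS.
case: (low_cases h) => [l | e]; last first.
  subst j; have l := lowSS h; rewrite (cosk_id_topE _ _ l b b).
  rewrite ltnNge (ltnW im) (gtn_eqF im) /= id_faceS bval_face; congr oid.
  case: eqP => [e | ne]; first by rewrite bval_of_face ltnn; apply: bval_irr.
  have im' : i < m by rewrite ltn_neqAle -ltnS im andbT; apply/eqP.
  rewrite IH // ltnNge (ltnW im') (gtn_eqF im') /= bval_of_face ltnn.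
  by rewrite (bval_irr x (lowS l) (low_pred h)).
rewrite (cosk_idE _ _ l); case: eqP => [e | ne].
  subst i; rewrite bval_of_face; have := low_m l.
  rewrite leq_eqVlt => /orP[/eqP e|jm]; last by rewrite jm; apply: bval_irr.
  by subst j; rewrite ltnn eqxx; apply: bval_irr.
have im' : i < m by rewrite ltn_neqAle -ltnS im andbT; apply/eqP.
rewrite IH // !bval_of_face !(bval_irr x (lowS l) h).
have := low_m l; rewrite leq_eqVlt => /orP[/eqP e|jm]; last first.
  by rewrite jm; case: ltngtP => // e; subst j; rewrite ?jm.
subst j; rewrite ltnn ltnNge (ltnW im') (gtn_eqF im') /=.
exact: id_face_bval.
Qed.

(** Both unit laws, the side of the identity being given by [s]. *)
Lemma cosk_comp_id s i m (x y : K m) (h : composable i x y) :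
  (if s then y else x) = id_face cosk_id s i (if s then x else y) ->
  cosk_comp h = (if s then x else y).
Proof.
move=> e; have im := composable_lt h; apply: cosk_cell_eq => j l b; rewrite bval_comp.
have ev := bval_id_face s (if s then x else y) l _ im; rewrite -e in ev.
case: ltngtP => [ji | ij | e'].
- by have := ev b; rewrite ji; case: (s) => [//|->].
- have := cosk_composable_above h l b b ij => c; rewrite -(tcompE c); move: c.
  have := ev b; rewrite ltnNge (ltnW ij) (gtn_eqF ij) /=.
  by case: (s) => -> c; [apply: ocomp_idr | apply: ocomp_idl].
subst j; have := ev b; rewrite ltnn eqxx; have := cosk_composable_at h l.
by case: (s) (b) => [] [] // <- //.
Qed.

Lemma cosk_comp_interchange i j m (x y x' y' : K m)
    (hxy : composable j x y) (hxy' : composable j x' y')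
    (hx : composable i x x') (hy : composable i y y')
    (h1 : composable i (cosk_comp hxy) (cosk_comp hxy'))
    (h2 : composable j (cosk_comp hx) (cosk_comp hy)) :
  i < j -> cosk_comp h1 = cosk_comp h2.
Proof.
move=> ij; apply: cosk_cell_eq => n l b; rewrite !bval_comp.
case: (ltngtP n j) => [nj | jn | e].
- by case: ltngtP => // e; subst n; rewrite nj.
- have lin := ltn_trans ij jn; rewrite ltnNge (ltnW lin) (gtn_eqF lin) /=.
  have c1 := cosk_composable_above hxy l b b jn.
  have c2 := cosk_composable_above hxy' l b b jn.
  have c3 := cosk_composable_above hx l b b lin.
  have c4 := cosk_composable_above hy l b b lin.
  have := cosk_composable_above h1 l b b lin; have := cosk_composable_above h2 l b b jn.
  rewrite !bval_comp !(gtn_eqF lin) !(gtn_eqF jn).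
  rewrite [n < i]ltnNge (ltnW lin) [n < j]ltnNge (ltnW jn) /=.
  rewrite -(tcompE c1) -(tcompE c2) -(tcompE c3) -(tcompE c4) => c6 c5.
  by rewrite -(tcompE c5) -(tcompE c6); apply: ocomp_interchange.
subst n; rewrite ltnNge (ltnW ij) (gtn_eqF ij) /=.
by case: b.
Qed.

Lemma cosk_id_comp i m (x y : K m) (h : composable i x y)
    (h' : composable i (cosk_id x) (cosk_id y)) : cosk_id (cosk_comp h) = cosk_comp h'.
Proof.
have im := composable_lt h; apply: cosk_cell_eq => j l b; rewrite bval_comp.
case: (low_cases l) => [l' | e]; first by rewrite !(cosk_idE _ _ l').
subst j; have l' := lowSS l; rewrite !(cosk_id_topE _ _ l' b b) bval_comp.
have im' : i < m.+1 := leqW im.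
rewrite ltnNge (ltnW im) (gtn_eqF im) ltnNge (ltnW im') (gtn_eqF im') /=.
have c := cosk_composable_above h l' b b im; rewrite -(tcompE c).
have := cosk_composable_above h' l b b im'; rewrite !(cosk_id_topE _ _ l' b b) => c'.
by rewrite -(tcompE c'); apply: oid_comp.
Qed.

Definition cosk_omega : omega_cat.
Proof.
apply: (@OmegaCat K cosk_id cosk_comp).
- exact: (face_cosk_id false).
- exact: (face_cosk_id true).
- exact: (face_cosk_comp_top false).
- exact: (face_cosk_comp_top true).
- by move=> j m x y h h'; apply: (@face_cosk_comp false).
- by move=> j m x y h h'; apply: (@face_cosk_comp true).
- exact: cosk_compA.
- by move=> j m x h; apply: (@cosk_comp_id false).
- by move=> j m x h; apply: (@cosk_comp_id true).
- exact: cosk_comp_interchange.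
- exact: cosk_id_comp.
Defined.
End CoskOmega.

(** * Locality of the free strict omega-category monad *)

Section CoskCells.
Context (k : nat) (C : gset).
Local Notation K := (cosk_gset k C).
Local Notation low := (low k).

Definition cosk_unit_gmap : gmap C K := cosk_ext (tr_incl k C).

Lemma cosk_unit_bval m (x : C m) (h : low m m) b : bval (cosk_unit_gmap m x) h b = x.
Proof. by rewrite /= iface_id. Qed.

End CoskCells.

Section CoskUnit.
Context (k : nat) (C : omega_cat).
Local Notation cosk_unit_gmap := (cosk_unit_gmap k C).

(** The canonical map to the coskeleton is an omega-functor: in low dimensions
    because the operations are those of [C], above because cells are determined by
    their faces. *)
Lemma cosk_unit_oid m (x : C m) : cosk_unit_gmap _ (oid x) =
  cosk_id (cosk_unit_gmap _ x : cosk_gset k C m).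
Proof.
case: (leqP m.+1 k) => [mk | km].
  apply: (cosk_eq_top (h := low_refl mk)).
  by rewrite cosk_unit_bval (cosk_id_topE _ _ (low_refl (ltnW mk)) _ false)
    cosk_unit_bval.
by apply: cosk_eq_face => // c; rewrite -gmap_face face_oid face_cosk_id.
Qed.

Lemma cosk_unit_comp i m (x y : C m) (h : composable i x y)
    (h' : composable i (cosk_unit_gmap _ x) (cosk_unit_gmap _ y)) :
  cosk_unit_gmap _ (ocomp h) = cosk_comp h'.
Proof.
elim: m x y h h' => [|m IH] x y h h'; first by have := composable_lt h.
have im := composable_lt h.
case: (leqP m.+1 k) => [mk | km].
  apply: (cosk_eq_top (h := low_refl mk)).
  rewrite bval_comp !cosk_unit_bval ltnNge (ltnW im) (gtn_eqF im) /=.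
  exact: tcompE.
apply: cosk_eq_face => // c; rewrite -gmap_face (tcompE h).
move: im; rewrite ltnS leq_eqVlt => /orP[/eqP e | im].
  by subst i; rewrite face_tcomp_top // face_cosk_comp_top gmap_face; case: (c).
rewrite face_tcomp //.
have hc := composable_face c im h; have hc' := composable_face c im h'.
rewrite (face_cosk_comp h' hc' im) -(tcompE hc).
by move: hc'; rewrite -!gmap_face => hc'; apply: IH.
Qed.

Definition cosk_unit_omap : omap C (cosk_omega k C) :=
  @OMap C (cosk_omega k C) cosk_unit_gmap cosk_unit_oid cosk_unit_comp.
End CoskUnit.

Lemma composable_reflect (A B : gset) (f : gmap A B) j m (x y : A m) :
  (forall i (a b : A i), i < m -> f i a = f i b -> a = b) ->
  composable j (f m x) (f m y) -> composable j x y.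
Proof.
elim: m x y => // m IH x y inj /=; case: ifP => _; rewrite -gmap_src -gmap_tgt.
  exact: inj.
by apply: IH => i a b im; apply: inj; apply: ltnW.
Qed.

Section FreeOmega.
Context (X : gset).

Lemma fev_unit j (q : free_omega X j) : fev (free_unit X) q = q.
Proof.
have := free_lift_uniq (oidm (free_omega X)).
have -> : gcomp (oidm (free_omega X)) (free_unit X) = free_unit X by apply: gmap_eq.
by move=> /(f_equal (fun h : omap _ _ => h j q)).
Qed.

(** Induction over pasting diagrams, from the raw composite that represents one: the
    interpretation of a raw composite in the free omega-category itself is the
    diagram that it represents. *)
Lemma free_ind (P : forall j, free_omega X j -> Prop) :
  (forall j (a : X j), P j (fgen a)) ->
  (forall j (q : free_omega X j), P j q -> P j.+1 (oid q)) ->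
  (forall i j (q r : free_omega X j) (h : composable i q r),
     P j q -> P j r -> P j (ocomp h)) ->
  forall j q, P j q.
Proof.
move=> Pgen Pid Pcomp j q; rewrite -(fev_unit q).
have := fevP (free_unit X) q; move: (fev _ q) => c; move: (frep q) c => {q} x.
elim: x => {j} [j a | j x IH | i j x IHx y IHy] c /=.
- by case=> <-.
- by case: ev IH => // d /(_ _ erefl) IH [<-]; apply: Pid.
case: ev IHx => // d /(_ _ erefl) IHx; case: ev IHy => // e /(_ _ erefl) IHy.
by case: excluded_middle_informative => // h [<-]; apply: Pcomp.
Qed.
End FreeOmega.

Section Locality.
Context (k : nat) (X : gset).

#[local] Transparent T eta mu.

Local Notation tX := (tr_gset k X).
Local Notation Tincl := (fmap T (tr_incl k X) : gmap (T tX) (T X)).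

(** The generators of the free omega-category on the truncation, as a map from the
    truncation of [X], extend to an omega-functor [G] from [T X] to a coskeleton.
    Its composite with [Tincl] is the canonical map to the coskeleton, as both agree
    on generators, and the latter is injective up to dimension [k]. *)
Lemma Tincl_inj j (w w' : T tX j) : j <= k -> Tincl j w = Tincl j w' -> w = w'.
Proof.
move=> jk e.
pose G := free_lift (C := cosk_omega k (free_omega tX))
  (cosk_ext (k := k) (free_unit tX)).
pose U := cosk_unit_omap k (free_omega tX).
pose I : omap (free_omega tX) (free_omega X) :=
  free_lift (gcomp (free_unit X) (tr_incl k X)).
have GU : ocompm G I = U.
  rewrite -(free_lift_uniq (ocompm G I)) -(free_lift_uniq U); congr free_lift.
  apply: cosk_map_ext => i x ik.
  have -> : gcomp (ocompm G I) (free_unit tX) i x =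
    cosk_ext (k := k) (free_unit tX) i (tval x).
    by rewrite /= fev_gen /= fev_gen.
  rewrite cosk_extK; have -> : gcomp U (free_unit tX) =
    cosk_ext (gcomp (free_unit tX) (tr_incl k tX)).
    apply: cosk_map_ext => n y nk; rewrite cosk_extK.
    exact: (@cosk_unit_bval k (free_omega tX)).
  by rewrite cosk_extK; congr fgen; apply: tr_cell_eq.
have {e} : ocompm G I j w = ocompm G I j w' by apply: (f_equal (G j) e).
rewrite GU => e; have := f_equal (fun z : cosk_gset k (free_omega tX) j =>
  bval z (low_refl jk) false) e.
by rewrite !(@cosk_unit_bval k (free_omega tX)).
Qed.

(** A composite in [T X] has the same dimension as its factors, so it lifts when
    these do; the lifts are composable by injectivity in lower dimensions. *)
Lemma Tincl_surj j (w : T X j) : j <= k -> exists w', Tincl j w' = w.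
Proof.
pose I : omap (free_omega tX) (free_omega X) :=
  free_lift (gcomp (free_unit X) (tr_incl k X)).
rewrite -[T X j]/(free_omega X j) in w *.
elim/(@free_ind X): w => [i a | i q IH | i n q r h IHq IHr] ik.
- exists (fgen (TrCell a ik : tX i));
  exact: (fev_gen (gcomp (free_unit X) (tr_incl k X))).
- by have [w' <-] := IH (ltnW ik); exists (oid (w' : free_omega tX i));
  apply: (omap_id I).
have [w' e] := IHq ik; have [v' e'] := IHr ik; subst q r.
have h' : composable i (w' : free_omega tX n) v'.
  apply: (composable_reflect (f := I)) h => l a b ln; apply: Tincl_inj.
  exact: leq_trans (ltnW ln) ik.
exists (ocomp h'); exact: (omap_comp (o := I)).
Qed.

Definition Tdown j (w : T X j) (h : j <= k) : T tX j :=
  sval (constructive_indefinite_description _ (Tincl_surj w h)).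

Lemma TdownK j (w : T X j) (h : j <= k) : Tincl j (Tdown w h) = w.
Proof. by rewrite /Tdown; case: constructive_indefinite_description. Qed.
End Locality.

(** * Maps of collections and of operads *)

Lemma tens_mapM (A A' A'' B B' B'' : coll) (f : coll_map A A') (f' : coll_map A' A'')
    (g : coll_map B B') (g' : coll_map B' B'') j (p : tens A B j) :
  tens_map f' g' j (tens_map f g j p) = tens_map (coll_comp f' f) (coll_comp g' g) j p.
Proof. by apply: tens_cell_eq; rewrite //= TmapM. Qed.

Lemma tens_map_ext (A A' B B' : coll) (f f' : coll_map A A') (g g' : coll_map B B') j
    (p : tens A B j) :
  (forall m (x : A m), f m x = f' m x) -> (forall m (x : B m), g m x = g' m x) ->
  tens_map f g j p = tens_map f' g' j p.
Proof. by move=> /coll_map_eq -> /coll_map_eq ->. Qed.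

Lemma is_opd_mapP (A B : coll) (sA : monoid_on Coll_tensor A)
  (sB : monoid_on Coll_tensor B)
    (f : coll_map A B) :
  is_opd_map sA sB f <->
  (forall j u, f j (one sA j u) = one sB j u) /\
  (forall j p, f j (mul sA j p) = mul sB j (tens_map f f j p)).
Proof.
split=> [[e1 eM] | [e1 eM]]; split; try (by apply: coll_map_eq; assumption).
  by move=> j u; exact: (f_equal (fun h : coll_map _ _ => h j u) e1).
by move=> j p; exact: (f_equal (fun h : coll_map _ _ => h j p) eM).
Qed.

(** The uniqueness half of a universal property of [P] under [A]. *)
Definition generates (A P : coll) (sP : monoid_on Coll_tensor P) (u : coll_map A P) :
  Prop :=
  forall (Q : coll) (sQ : monoid_on Coll_tensor Q) (h h' : coll_map P Q),
  is_opd_map sP sQ h -> is_opd_map sP sQ h' ->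
  (forall j a, h j (u j a) = h' j (u j a)) -> h = h'.

Lemma kopd_iso k (B B' : KOpd k) (f : hom B B')
  (g : coll_map (mcar B' : kcoll k) (mcar B : kcoll k)) :
  coll_comp (mmap f) g = coll_id _ -> coll_comp g (mmap f) = coll_id _ -> is_iso f.
Proof.
move=> fg gf.
have gM : is_monoid_map (mstr B') (mstr B) g.
  exact: (is_monoid_map_inv (C := KCollCat k) (t := KColl_tensor k) fg gf (mmapP f)).
exists (@MonoidOverMap _ _ _ _ B' B g gM).
by split; apply: monoid_over_map_eq.
Qed.

Lemma kopd_opd_restrict k (A : coll) (s : monoid_on Coll_tensor A) :
  kopd_restrict (opd_restrict k.+1 s) = opd_restrict k s.
Proof.
apply: monoid_on_eq; apply: coll_map_eq => j x; apply: tr_cell_eq => //=.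
apply: (f_equal (mul s j)); apply: tens_cell_eq; rewrite //= -!TmapM.
exact: Tmap_ext.
Qed.

Lemma coll_inverse (A B : coll) (f : coll_map A B) : (forall j, bijective (f j)) ->
  exists g : coll_map B A, coll_comp f g = coll_id B /\ coll_comp g f = coll_id A.
Proof.
move=> bij.
have ex j (y : B j) : exists x, f j x = y by have [g _ fg] := bij j; exists (g y).
pose g j (y : B j) := sval (constructive_indefinite_description _ (ex j y)).
have fg j (y : B j) : f j (g j y) = y by rewrite /g;
  case: constructive_indefinite_description.
have inj j := bij_inj (bij j).
have gb c j (y : B j.+1) : g j (face c y) = face c (g j.+1 y).
  by apply: inj; rewrite fg gmap_face fg.
have ga j (y : B j) : arity A j (g j y) = arity B j y by rewrite -(cmap_arity f) fg.
exists (@CollMap B A (@GMap B A g (gb false) (gb true)) ga).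
by split; apply: coll_map_eq => j x; [apply: fg | apply: inj; apply: fg].
Qed.

Lemma tr_map_bij k (A B : coll) (f : coll_map A B) j :
  (j <= k -> bijective (f j)) -> bijective (tr_map k f j).
Proof.
move=> bij; apply: inj_surj_bij => [x y /(f_equal (@tval _ _ _)) /= e | [y jk]].
  by apply: tr_cell_eq; apply: (bij_inj (bij (tle x))).
by have [g _ fg] := bij jk; exists (TrCell (g y) jk); apply: tr_cell_eq; apply: fg.
Qed.

(** * The coskeleton of a k-operad *)

Section TensorDown.
Context (k : nat).

Lemma Tdown_face (X : gset) c j (w : T X j.+1) (h : j.+1 <= k) (h' : j <= k) :
  Tdown (face c w) h' = face c (Tdown w h).
Proof. by apply: (@Tincl_inj k X) => //; rewrite TdownK gmap_face TdownK. Qed.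

(** The comparison between the truncation of a tensor product and the tensor product
    of the truncations, which rests on the locality of [T]. *)
Program Definition tens_down (A B : coll) :
    coll_map (tr_coll k (tens A B)) (tens (tr_coll k A) (tr_coll k B)) :=
  @CollMap (tr_coll k (tens A B)) (tens (tr_coll k A) (tr_coll k B))
    (@GMap (tr_coll k (tens A B)) (tens (tr_coll k A) (tr_coll k B)) (fun j p =>
       @TensCell (tr_coll k A) (tr_coll k B) j
         (@TrCell A k j (tfst (tval p)) (tle p)) (Tdown (tsnd (tval p)) (tle p)) _) _ _)
           _.
Next Obligation.
move=> A B j p; rewrite /= tensP -[in LHS](TdownK (tsnd (tval p)) (tle p)).
exact: Tmap_bang.
Qed.
Next Obligation.
move=> A B j p; apply: tens_cell_eq => /=; first exact: tr_cell_eq.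
exact: (Tdown_face false).
Qed.
Next Obligation.
move=> A B j p; apply: tens_cell_eq => /=; first exact: tr_cell_eq.
exact: (Tdown_face true).
Qed.
Next Obligation.
move=> A B j p; rewrite /= -[in RHS](TdownK (tsnd (tval p)) (tle p)).
by rewrite -TmapM.
Qed.

Lemma tens_downK (A B : coll) j (p : tr_coll k (tens A B) j) :
  tens_map (tr_incl_coll k A) (tr_incl_coll k B) j (tens_down A B j p) = tval p.
Proof. by apply: tens_cell_eq; rewrite //= TdownK. Qed.

Lemma tens_down_nat (A B A' B' : coll) (f : coll_map A A') (g : coll_map B B') j
    (p : tr_coll k (tens A B) j) :
  tens_down A' B' j (tr_map k (tens_map f g) j p) =
  tens_map (tr_map k f) (tr_map k g) j (tens_down A B j p).
Proof.
apply: tens_cell_eq => /=; first exact: tr_cell_eq.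
apply: Tincl_inj; first exact: tle p.
rewrite TdownK -[in LHS](TdownK (tsnd (tval p)) (tle p)) -!TmapM.
exact: Tmap_ext.
Qed.

(** If all low cells of [A] and [B] come from [A'] and [B'], then so do those of
    the tensor product. *)
Lemma tens_low (A B A' B' : coll) (f : coll_map A' A) (g : coll_map B' B)
    (f' : coll_map (tr_coll k A) A') (g' : coll_map (tr_coll k B) B') :
  (forall j x, f j (f' j x) = tval x) -> (forall j x, g j (g' j x) = tval x) ->
  forall j (p : tr_coll k (tens A B) j),
  tens_map f g j (tens_map f' g' j (tens_down A B j p)) = tval p.
Proof.
move=> ff gg j p; rewrite tens_mapM -[RHS]tens_downK.
by apply: tens_map_ext => m x /=; rewrite ?ff ?gg.
Qed.
End TensorDown.

Section OperadCosk.
Context (k : nat) (Y : coll) (s : monoid_on (KColl_tensor k) (tr_coll k Y)).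

Local Notation K := (cosk_gset k).
Local Notation trY := (kcar (tr_coll k Y)).

(** The coskeleton over [T 1]: the pullback of the coskeleton of [Y] and of [T 1]
    over the coskeleton of [T 1]. Above dimension [k], a cell is thus a boundary and
    an arity that are compatible. *)
Record copd_cell m := CopdCell {
  copd_bd : K Y m;
  copd_ar : T gone m;
  copd_arP : cosk_ext (gcomp (arity Y) (cosk_low k Y)) m copd_bd =
    cosk_ext (tr_incl k (T gone)) m copd_ar
}.

Lemma copd_cell_eq m (x y : copd_cell m) :
  copd_bd x = copd_bd y -> copd_ar x = copd_ar y -> x = y.
Proof.
case: x y => [x a h] [y b h'] /= e1 e2; subst y b.
by congr CopdCell; apply: proof_irrelevance.
Qed.

Program Definition copd_gset : gset :=
  @GSetObj copd_cell (fun m x => @CopdCell m (src (copd_bd x)) (src (copd_ar x)) _)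
    (fun m x => @CopdCell m (tgt (copd_bd x)) (tgt (copd_ar x)) _) _ _.
Next Obligation. by move=> m x; rewrite !gmap_src copd_arP. Qed.
Next Obligation. by move=> m x; rewrite !gmap_tgt copd_arP. Qed.
Next Obligation. by move=> m x; apply: copd_cell_eq; apply: src_tgt. Qed.
Next Obligation. by move=> m x; apply: copd_cell_eq; apply: tgt_src. Qed.

Definition copd_coll : coll :=
  @CollObj copd_gset (@GMap copd_gset (T gone) copd_ar (fun _ _ => erefl)
    (fun _ _ => erefl)).
Local Notation E := copd_coll.
Local Notation trE := (kcar (tr_coll k E)).

Definition copd_fst : gmap E (K Y) := @GMap E (K Y) copd_bd (fun _ _ => erefl)
  (fun _ _ => erefl).

Program Definition copd_low : coll_map trE trY :=
  @CollMap trE trY (@GMap trE trY (fun j x =>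
    @TrCell Y k j (cosk_low k Y j (@TrCell (K Y) k j (copd_bd (tval x)) (tle x))) (tle x))
      _ _) _.
Next Obligation. by move=> j x; apply: tr_cell_eq; apply/esym/(bval_faceE false). Qed.
Next Obligation.
by move=> j x; apply: tr_cell_eq; rewrite /= eqxx; apply/esym/(bval_faceE true).
Qed.
Next Obligation.
move=> j [x h]; have := f_equal (fun z => cosk_low k _ j (@TrCell (K _) k j z h))
  (copd_arP x).
by rewrite !cosk_extK.
Qed.

Lemma copd_low_inj j (x y : trE j) : copd_low j x = copd_low j y -> x = y.
Proof.
move=> e; apply: tr_cell_eq; apply: copd_cell_eq; last first.
  by rewrite -[copd_ar _]/(arity trE j x) -[RHS]/(arity trE j y) -!(cmap_arity copd_low)
    e.
case: x y e => [x h] [y h'] /(f_equal (@tval _ _ _)) /=.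
by rewrite (bool_irrelevance h' h); apply: cosk_eq_top.
Qed.

(** A cell is determined by its arity and its low boundary, so that equations between
    maps to the coskeleton only need to be checked on low cells. The operad axioms and
    the preservation of operad structures are such equations. *)
Lemma copd_map_ext (X : coll) (f g : coll_map X E) :
  (forall j (x : X j) (h : j <= k), f j x = g j x) -> f = g.
Proof.
move=> e; apply: coll_map_eq => m x; apply: copd_cell_eq; last first.
  by rewrite -[copd_ar _]/(arity E m _) -[RHS]/(arity E m _) !cmap_arity.
have : gcomp copd_fst f = gcomp copd_fst g.
  by apply: cosk_map_ext => j z h; rewrite /= e.
by move=> /(f_equal (fun h : gmap _ _ => h m x)).
Qed.

Section Ext.
Context (X : coll) (g : coll_map (tr_coll k X) trY).

Program Definition copd_ext : coll_map X E :=
  @CollMap X E (@GMap X E (fun m x =>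
    @CopdCell m (cosk_ext (gcomp (tr_incl k Y) g) m x) (arity X m x) _) _ _)
      (fun _ _ => erefl).
Next Obligation.
move=> m x; pose l := gcomp (cosk_ext (gcomp (arity Y) (cosk_low k Y)))
  (cosk_ext (gcomp (tr_incl k Y) g)).
pose r := gcomp (cosk_ext (tr_incl k (T gone))) (arity X).
have : l = r; last by move=> /(f_equal (fun h : gmap _ _ => h m x)).
apply: cosk_map_ext => j z h;
  rewrite /l /r -[LHS]/(cosk_low k _ j (TrCell (cosk_ext _ j _) h)).
rewrite -[RHS]/(cosk_low k _ j (TrCell (cosk_ext _ j _) h))
  (cosk_extK (gcomp (arity Y) _)).
rewrite (cosk_extK (tr_incl k (T gone))).
apply: etrans (f_equal (arity Y j) (cosk_extK (gcomp (tr_incl k Y) g) z h)) _.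
exact: (cmap_arity g).
Qed.
Next Obligation.
move=> m x; apply: copd_cell_eq; last exact: gmap_src.
exact: (gmap_src (cosk_ext (gcomp (tr_incl k Y) g))).
Qed.
Next Obligation.
move=> m x; apply: copd_cell_eq; last exact: gmap_tgt.
exact: (gmap_tgt (cosk_ext (gcomp (tr_incl k Y) g))).
Qed.

Lemma copd_extK j (x : tr_coll k X j) (h : j <= k) :
  copd_low j (@TrCell E k j (copd_ext j (tval x)) h) = g j x.
Proof.
apply: tr_cell_eq; rewrite /= iface_id.
by congr (tval (g j _)); apply: tr_cell_eq.
Qed.
End Ext.

Definition copd_unit : coll_map Y E := copd_ext (coll_id trY).

(** The inverse of [copd_low], in the form of a map to the coskeleton. *)
Definition copd_incl : coll_map trY E := coll_comp copd_unit (tr_incl_coll k Y).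

Lemma copd_low_incl j (y : trY j) (h : j <= k) :
  copd_low j (@TrCell E k j (copd_incl j y) h) = y.
Proof. exact: (copd_extK (coll_id trY)). Qed.

Lemma copd_incl_low j (x : trE j) : copd_incl j (copd_low j x) = tval x.
Proof.
have e : x = @TrCell E k j (copd_incl j (copd_low j x)) (tle x).
  by apply: copd_low_inj; rewrite copd_low_incl.
by rewrite [in RHS]e.
Qed.

Lemma copd_ext_incl (X : coll) (g : coll_map (tr_coll k X) trY) j (x : tr_coll k X j) :
  copd_ext g j (tval x) = copd_incl j (g j x).
Proof. by rewrite -(copd_extK g x (tle x)) copd_incl_low. Qed.

(** The operations of [Y], extended above dimension [k] in the only possible way. *)
Definition copd_one : coll_map coll_unit E := copd_ext (one s).
Definition copd_mul : coll_map (tens E E) E :=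
  copd_ext (coll_comp (mul s) (coll_comp (tens_map copd_low copd_low) (tens_down k E E))).

Lemma copd_oneE j (u : tr_coll k coll_unit j) : copd_one j (tval u) =
  copd_incl j (one s j u).
Proof. exact: copd_ext_incl. Qed.

Lemma copd_tens_down j (q : tens trY trY j) (jk : j <= k) :
  tens_map copd_low copd_low j (tens_down k E E j
    (TrCell (tens_map copd_incl copd_incl j q) jk)) = q.
Proof.
rewrite -[TrCell _ _]/(tr_map k (tens_map copd_incl copd_incl) j
  (@TrCell (tens trY trY) k j q jk)).
rewrite tens_down_nat tens_mapM -[RHS]/(tval (@TrCell (tens trY trY) k j q jk))
  -tens_downK.
by apply: tens_map_ext => m x; apply: copd_low_incl.
Qed.

(** As all low cells of [E] and of its tensor powers come from [Y], this determines
    the composition of [E], and the axioms of [E] reduce to those of [Y]. *)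
Lemma copd_mulE j (q : tens trY trY j) :
  copd_mul j (tens_map copd_incl copd_incl j q) = copd_incl j (mul s j q).
Proof.
have jk : j <= k := tle (tfst q).
rewrite -[tens_map _ _ _ _]/(tval (@TrCell (tens E E) k j
  (tens_map copd_incl copd_incl j q) jk)).
rewrite copd_ext_incl; congr (copd_incl j (mul s j _)).
exact: copd_tens_down.
Qed.

Definition copd_tens_low : coll_map (tr_coll k (tens E E)) (tens trY trY) :=
  coll_comp (tens_map copd_low copd_low) (tens_down k E E).

Lemma copd_tens_lowK j (p : tr_coll k (tens E E) j) :
  tens_map copd_incl copd_incl j (copd_tens_low j p) = tval p.
Proof. by apply: tens_low => m x; apply: copd_incl_low. Qed.

Lemma copd_assoc j (p : tens E (tens E E) j) : j <= k ->
  copd_mul j (tens_map (coll_id E) copd_mul j p) =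
  copd_mul j (tens_map copd_mul (coll_id E) j (coll_assoc E E E j p)).
Proof.
move=> jk; rewrite -[p]/(tval (@TrCell (tens E (tens E E)) k j p jk)).
rewrite -(tens_low copd_incl_low copd_tens_lowK).
move: (tens_map copd_low copd_tens_low j _) => q; rewrite tens_mapM.
rewrite (tens_map_ext (f' := coll_comp copd_incl (coll_id trY))
  (g' := coll_comp copd_incl (mul s)) q) //;
  last exact: copd_mulE.
rewrite -tens_mapM copd_mulE coll_assoc_nat tens_mapM.
rewrite (tens_map_ext (f' := coll_comp copd_incl (mul s))
  (g' := coll_comp copd_incl (coll_id trY))) //;
  last exact: copd_mulE.
by rewrite -tens_mapM copd_mulE; congr (copd_incl j _); apply: kopd_assoc.
Qed.

Lemma copd_one_l j (x : E j) : j <= k ->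
  copd_mul j (tens_map copd_one (coll_id E) j (coll_lunit E j x)) = x.
Proof.
move=> jk; rewrite -[x]/(tval (@TrCell E k j x jk)) -copd_incl_low.
move: (copd_low _ _) => y.
pose u := @TrCell coll_unit k j tt jk.
have h : arity trY j (one s j u) = fmap T (bang trY) j (eta trY j y).
  by rewrite cmap_arity /= -eta_nat.
pose q := @TensCell trY trY j (one s j u) (eta trY j y) h.
rewrite -[RHS](f_equal (copd_incl j) (kopd_one_l (p := q) erefl erefl)) -copd_mulE.
congr (copd_mul j _); apply: tens_cell_eq; first exact: (copd_oneE u).
by rewrite [LHS]Tmap1 -[RHS]eta_nat.
Qed.

Lemma copd_one_r j (p : tens E coll_unit j) : j <= k ->
  copd_mul j (tens_map (coll_id E) copd_one j p) = tfst p.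
Proof.
move=> jk; rewrite -[p]/(tval (@TrCell (tens E coll_unit) k j p jk)).
rewrite -(tens_low copd_incl_low (g := tr_incl_coll k coll_unit) (g' := coll_id _)) //.
move: (tens_map copd_low (coll_id _) j _) => q; rewrite tens_mapM.
rewrite (tens_map_ext (f' := coll_comp copd_incl (coll_id trY))
  (g' := coll_comp copd_incl (one s)) q) //;
  last exact: copd_oneE.
by rewrite -tens_mapM copd_mulE kopd_one_r.
Qed.

Definition copd_opd : monoid_on Coll_tensor E.
Proof.
apply: (@MonoidOn Coll Coll_tensor E copd_one copd_mul).
- by apply: copd_map_ext => j p; apply: copd_assoc.
- by apply: copd_map_ext => j p; apply: copd_one_l.
- by apply: copd_map_ext => j p; apply: copd_one_r.
Defined.

Lemma copd_unit_kopd : is_kopd_map k s (opd_restrict k copd_opd) (tr_map k copd_unit).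
Proof.
split; apply: coll_map_eq => j x; apply: tr_cell_eq; first exact/esym/(copd_oneE x).
rewrite -[LHS]/(copd_incl j (mul s j x)) -copd_mulE.
by apply: (f_equal (copd_mul j)); rewrite [RHS]tens_mapM; apply: tens_map_ext.
Qed.

(** A map to the coskeleton that preserves the operad structure in low dimensions
    preserves all of it, since its values in high dimensions are determined. *)
Lemma copd_ext_opd (P : coll) (sP : monoid_on Coll_tensor P)
    (g : coll_map (tr_coll k P) trY) :
  is_kopd_map k (opd_restrict k sP) s g ->
  is_opd_map sP copd_opd (copd_ext g).
Proof.
move=> [g1 gM]; split; apply: copd_map_ext => j p jk.
  pose u := @TrCell coll_unit k j p jk.
  have e : g j (one (opd_restrict k sP) j u) = one s j u.
    exact: (f_equal (fun h : coll_map (tr_coll k coll_unit) trY => h j u) g1).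
  rewrite -[RHS]/(copd_one j (tval u)) copd_oneE -e -copd_ext_incl.
  by [].
pose p' := @TrCell (tens P P) k j p jk.
pose q := tens_down k P P j p'.
have e : g j (mul (opd_restrict k sP) j q) = mul s j (tens_map g g j q).
  exact: (f_equal (fun h : coll_map (tens (tr_coll k P) (tr_coll k P)) trY => h j q) gM).
have := f_equal (copd_incl j) e; rewrite -copd_ext_incl -copd_mulE.
rewrite -[tval _]/(mul sP j (tens_map (tr_incl_coll k P) (tr_incl_coll k P) j q)).
rewrite tens_downK => e'; apply: (etrans e').
rewrite -[p in RHS]/(tval p') -tens_downK.
apply: (f_equal (copd_mul j)).
rewrite [LHS]tens_mapM [RHS]tens_mapM; apply: tens_map_ext => m x;
  exact/esym/copd_ext_incl.
Qed.

Lemma copd_low_kopd : is_kopd_map k (opd_restrict k copd_opd) s copd_low.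
Proof.
apply: (is_monoid_map_inv (C := KCollCat k) (t := KColl_tensor k) _ _ copd_unit_kopd).
  by apply: coll_map_eq => j x; apply: tr_cell_eq; apply: copd_incl_low.
by apply: coll_map_eq => j x; apply: copd_low_incl.
Qed.

(** The other direction of the adjunction between truncation and coskeleton. *)
Definition copd_part (P : coll) (h : coll_map P E) : coll_map (tr_coll k P) trY :=
  coll_comp copd_low (tr_map k h).

Lemma copd_part_kopd (P : coll) (sP : monoid_on Coll_tensor P) (h : coll_map P E) :
  is_opd_map sP copd_opd h -> is_kopd_map k (opd_restrict k sP) s (copd_part h).
Proof.
by move=> hM; apply: (is_monoid_map_cmp copd_low_kopd (opd_restrict_map k hM)).
Qed.

Lemma copd_partE (P : coll) (h : coll_map P E) j (x : tr_coll k P j) (y : trY j) :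
  h j (tval x) = copd_unit j (tval y) -> copd_part h j x = y.
Proof.
move=> e; rewrite -[RHS](copd_low_incl y (tle x)).
by apply: (f_equal (copd_low j)); apply: tr_cell_eq.
Qed.

(** A universal property of [P] descends to its truncation: two maps of [k]-operads
    to [Y] extend to operad maps to the coskeleton of [Y]. *)
Lemma generates_low (A P : coll) (sP : monoid_on Coll_tensor P) (u : coll_map A P)
    (g g' : coll_map (tr_coll k P) trY) :
  generates sP u ->
  is_kopd_map k (opd_restrict k sP) s g ->
  is_kopd_map k (opd_restrict k sP) s g' ->
  (forall j a (h : j <= k), g j (TrCell (u j a) h) = g' j (TrCell (u j a) h)) -> g = g'.
Proof.
move=> uP gM gM' e.
have ee : copd_ext g = copd_ext g'.
  apply: (uP _ _ _ _ (copd_ext_opd gM) (copd_ext_opd gM')) => j a.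
  suff : coll_comp (copd_ext g) u = coll_comp (copd_ext g') u.
    by move=> /(f_equal (fun h : coll_map _ _ => h j a)).
  apply: copd_map_ext => i x ik.
  have := copd_ext_incl g (TrCell (u i x) ik);
    have := copd_ext_incl g' (TrCell (u i x) ik).
  by rewrite e /= => -> ->.
by apply: coll_map_eq => j x; rewrite -(copd_extK g x (tle x)) ee copd_extK.
Qed.

End OperadCosk.

(** * A weakly universal operad under a collection *)

(** Operations satisfy the operad axioms as soon as the maps to operads that
    preserve these operations are jointly injective. *)
Section SeparatedMonoid.
Context (B : coll) (e : coll_map coll_unit B) (m : coll_map (tens B B) B).
Context (sep : forall j (x y : B j),
  (forall (P : coll) (sP : monoid_on Coll_tensor P) (h : coll_map B P),
     (forall i u, h i (e i u) = one sP i u) ->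
     (forall i p, h i (m i p) = mul sP i (tens_map h h i p)) -> h j x = h j y) ->
  x = y).

Definition sep_monoid : monoid_on Coll_tensor B.
Proof.
apply: (@MonoidOn Coll Coll_tensor B e m); apply: coll_map_eq => j p;
  apply: sep => P sP h h1 hM.
- rewrite [LHS]hM [RHS]hM -[tens_map _ _ j (coll_assoc _ _ _ _ _)]/(tens_map _ _ _ _).
  rewrite [X in mul sP j X = _]tens_mapM [X in _ = mul sP j X]tens_mapM.
  rewrite (tens_map_ext (f' := coll_comp (coll_id P) h)
    (g' := coll_comp (mul sP) (tens_map h h)) p) //.
  rewrite -tens_mapM opd_assoc coll_assoc_nat.
  by rewrite tens_mapM; apply: (f_equal (mul sP j)); apply: tens_map_ext => n x //=.
- rewrite [LHS]hM.
  by apply: (opd_one_l (u := tt)); [exact: h1 | rewrite /= Tmap1 -eta_nat].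
rewrite [LHS]hM [X in mul sP j X]tens_mapM.
rewrite (tens_map_ext (f' := coll_comp (coll_id P) h)
  (g' := coll_comp (one sP) (coll_id coll_unit)) p) //.
by rewrite -tens_mapM opd_one_r.
Defined.
End SeparatedMonoid.

(** The terminal operad has one cell for each arity. *)
Definition terminal_coll : coll := @CollObj (T gone) (gid (T gone)).

Definition terminal_map (X : coll) : coll_map X terminal_coll :=
  @CollMap X terminal_coll (arity X) (fun _ _ => erefl).

Lemma terminal_map_uniq (X : coll) (f g : coll_map X terminal_coll) : f = g.
Proof.
by apply: coll_map_eq => j x; apply: etrans (cmap_arity f x) (esym (cmap_arity g x)).
Qed.

Definition terminal_opd : monoid_on Coll_tensor terminal_coll.
Proof.
by apply: (@MonoidOn Coll Coll_tensor terminal_coll (terminal_map _) (terminal_map _));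
  apply: terminal_map_uniq.
Defined.

(** [Phi] selects the admissible maps from [A] to operads. *)
Section WeaklyInitial.
Context (A : coll).
Context (Phi : forall P : coll, monoid_on Coll_tensor P -> coll_map A P -> Prop).
Context (Phi_t : Phi terminal_opd (terminal_map A)).

Record model := Model {
  model_coll : coll;
  model_opd : monoid_on Coll_tensor model_coll;
  model_map : coll_map A model_coll;
  modelP : Phi model_opd model_map
}.

(** Formal composites: [term false j] consists of formal [j]-cells of an operad under
    [A], and [term true j] of formal pasting diagrams of those, which stand for cells
    of [T]. Faces are formal too, as this spares their computation by recursion. *)
Inductive term : bool -> nat -> Type :=
| Gen j of A j : term false j
| One j : term false j
| Mul j of term false j & term true j : term false j
| Face (c : bool) j of term false j.+1 : term false j
| Cell j of term false j : term true j
| Idt j of term true j : term true j.+1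
| Cmp (i : nat) j of term true j & term true j : term true j.

#[local] Transparent T eta mu.

Definition value (M : model) (b : bool) j : Type :=
  if b then free_omega (model_coll M) j else model_coll M j.

(** The partial value of a formal composite along an admissible map. *)
Fixpoint eval (M : model) b j (x : term b j) : option (value M b j) :=
  match x in term b j return option (value M b j) with
  | Gen j a => Some (model_map M j a)
  | One j => Some (one (model_opd M) j tt)
  | Mul j x v =>
      match eval M x, eval M v with
      | Some p, Some w =>
          match excluded_middle_informative (arity (model_coll M) j p =
            fmap T (bang (model_coll M)) j w) with
          | left h => Some (mul (model_opd M) j
            (@TensCell (model_coll M) (model_coll M) j p w h))
          | right _ => None
          end
      | _, _ => None
      end
  | Face c j x => if eval M x is Some p then Some (face c (p : model_coll M j.+1)) else
    None
  | Cell j x => if eval M x is Some p then Some (eta (model_coll M) j p) else None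
  | Idt j v => if eval M v is Some w then Some (oid (w : free_omega (model_coll M) j))
    else None
  | Cmp i j v w =>
      match eval M v, eval M w with
      | Some c, Some d =>
          match excluded_middle_informative (composable i
            (c : free_omega (model_coll M) j) d) with
          | left h => Some (ocomp h)
          | right _ => None
          end
      | _, _ => None
      end
  end.

Definition map_value (M M' : model) (h : coll_map (model_coll M) (model_coll M')) b j :
  value M b j -> value M' b j :=
  match b return value M b j -> value M' b j with
  | true => fun w => fmap T h j w
  | false => fun p => h j p
  end.

Lemma eval_nat (M M' : model) (h : coll_map (model_coll M) (model_coll M')) b j
  (x : term b j) c :
  is_opd_map (model_opd M) (model_opd M') h ->
  (forall i a, h i (model_map M i a) = model_map M' i a) ->
  eval M x = Some c -> eval M' x = Some (map_value h c).
Proof.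
move=> /is_opd_mapP[h1 hM] hf.
elim: x c => {b j} [j a | j | j x IHx v IHv | s j x IH | j x IH | j x IH | i j x IHx y
  IHy] c /=.
- by case=> <-; rewrite -hf.
- by case=> <-; rewrite -h1.
- case: (eval M x) IHx => // p /(_ _ erefl) ->;
  case: (eval M v) IHv => // w /(_ _ erefl) ->.
  case: excluded_middle_informative => // e [<-].
  case: excluded_middle_informative => [e'|[]]; last first.
    by apply: etrans (cmap_arity h p) _; rewrite e; apply/esym/Tmap_bang.
  congr Some; apply/esym; apply: etrans (hM _ _) _.
  by apply: (f_equal (mul (model_opd M') j)); apply: tens_cell_eq.
- by case: (eval M x) IH => // p /(_ _ erefl) -> [<-]; rewrite /= gmap_face.
- by case: (eval M x) IH => // p /(_ _ erefl) -> [<-]; congr Some; apply: eta_nat.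
- case: (eval M x) IH => // p /(_ _ erefl) -> [<-] /=; congr Some.
  exact/esym/(omap_id (free_lift (gcomp (free_unit _) h))).
case: (eval M x) IHx => // p /(_ _ erefl) ->; case: (eval M y) IHy =>
  // w /(_ _ erefl) ->.
case: excluded_middle_informative => // e [<-].
have e2 := composable_map (free_lift (gcomp (free_unit _) h)) e.
case: excluded_middle_informative => [e'|[]] //; congr Some.
exact/esym/(omap_comp (o := free_lift (gcomp (free_unit _) h))).
Qed.

Definition defined j (x : term false j) : Prop :=
  forall M, exists c : model_coll M j, eval M x = Some c.

Definition agree j (x y : term false j) : Prop := forall M, eval M x = eval M y.

(** The equivalence classes of composites that have the same values are represented
    by chosen members. This makes the type of classes as small as that of terms,
    although models range over all operads. *)
Definition choice_of j (x : term false j) : term false j :=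
  epsilon (inhabits x) (agree x).

Lemma choice_agree j (x : term false j) : agree x (choice_of x).
Proof. by apply: epsilon_spec; exists x. Qed.

Lemma agree_choice j (x y : term false j) : agree x y -> choice_of x = choice_of y.
Proof.
move=> xy; rewrite /choice_of (proof_irrelevance _ (inhabits x) (inhabits y)).
congr epsilon; apply: functional_extensionality => z.
by apply: propositional_extensionality; split=> h M; rewrite -h ?xy.
Qed.

Record weak_cell j := WeakCell {
  weak_rep : term false j;
  weak_rep_defined : defined weak_rep;
  weak_rep_choice : choice_of weak_rep = weak_rep
}.

Definition weak_val M j (q : weak_cell j) : model_coll M j :=
  sval (constructive_indefinite_description _ (weak_rep_defined q M)).

Lemma weak_valP M j (q : weak_cell j) : eval M (weak_rep q) = Some (weak_val M q).
Proof. by rewrite /weak_val; case: constructive_indefinite_description. Qed.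

Program Definition weak_cls j (x : term false j) (h : defined x) : weak_cell j :=
  @WeakCell j (choice_of x) _ _.
Next Obligation. by move=> j x h M; rewrite -(choice_agree x). Qed.
Next Obligation. by move=> j x h; apply/esym/agree_choice/choice_agree. Qed.

Lemma weak_val_cls M j (x : term false j) (h : defined x) c :
  eval M x = Some c -> weak_val M (weak_cls h) = c.
Proof. by move=> e; apply: Some_inj; rewrite -weak_valP -(choice_agree x). Qed.

Lemma weak_cell_ext j (q r : weak_cell j) :
  (forall M, weak_val M q = weak_val M r) -> q = r.
Proof.
move=> h; have e : weak_rep q = weak_rep r.
  rewrite -(weak_rep_choice q) -(weak_rep_choice r); apply: agree_choice => M.
  by rewrite !weak_valP h.
case: q r e {h} => [x hx cx] [y hy cy] /= e; subst y.
by congr WeakCell; apply: proof_irrelevance.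
Qed.

Lemma defined_face c j (q : weak_cell j.+1) : defined (Face c (weak_rep q)).
Proof. by move=> M; exists (face c (weak_val M q)); rewrite /= weak_valP. Qed.

Definition weak_face c j (q : weak_cell j.+1) : weak_cell j :=
  weak_cls (defined_face c q).

Lemma weak_val_face M c j (q : weak_cell j.+1) : weak_val M (weak_face c q) =
  face c (weak_val M q).
Proof. by apply: weak_val_cls; rewrite /= weak_valP. Qed.

Program Definition weak_gset : gset := @GSetObj weak_cell (weak_face false)
  (weak_face true) _ _.
Next Obligation.
by move=> j q; apply: weak_cell_ext => M; rewrite !weak_val_face [LHS]src_tgt.
Qed.
Next Obligation.
by move=> j q; apply: weak_cell_ext => M; rewrite !weak_val_face [LHS]tgt_src.
Qed.

Definition terminal_model : model := Model Phi_t.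

(** The terminal operad is a model, so that the value there can serve as the arity of
    a class; it is the arity of all other values as well. *)
Lemma weak_val_arity M j (q : weak_cell j) : arity (model_coll M) j (weak_val M q) =
  weak_val terminal_model q.
Proof.
have h : is_opd_map (model_opd M) (model_opd terminal_model)
  (terminal_map (model_coll M)).
  by split; apply: terminal_map_uniq.
have := @eval_nat M terminal_model (terminal_map (model_coll M)) false j (weak_rep q)
  (weak_val M q) h.
by move=> /(_ (cmap_arity (model_map M)) (weak_valP M q)); rewrite weak_valP => -[].
Qed.

Definition weak_coll : coll :=
  @CollObj weak_gset (@GMap weak_gset (T gone) (@weak_val terminal_model)
    (fun j => @weak_val_face terminal_model false j)
      (fun j => @weak_val_face terminal_model true j)).
Local Notation L := weak_coll.

Definition weak_map (M : model) : coll_map L (model_coll M) :=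
  @CollMap L (model_coll M) (@GMap L (model_coll M) (@weak_val M)
    (fun j => @weak_val_face M false j) (fun j => @weak_val_face M true j))
      (@weak_val_arity M).

Lemma defined_gen j (a : A j) : defined (Gen a).
Proof. by move=> M; exists (model_map M j a). Qed.

Lemma weak_val_gen M j (a : A j) : weak_val M (weak_cls (defined_gen a)) =
  model_map M j a.
Proof. exact: weak_val_cls. Qed.

Program Definition weak_gen : coll_map A L :=
  @CollMap A L (@GMap A L (fun j a => weak_cls (defined_gen a)) _ _) _.
Next Obligation.
move=> j a; apply: weak_cell_ext => M; apply: etrans _ (esym (weak_val_face M false _)).
by rewrite !weak_val_gen -gmap_face.
Qed.
Next Obligation.
move=> j a; apply: weak_cell_ext => M; apply: etrans _ (esym (weak_val_face M true _)).
by rewrite !weak_val_gen -gmap_face.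
Qed.
Next Obligation. by move=> j a; apply: (weak_val_gen terminal_model). Qed.

Lemma weak_map_gen M j (a : A j) : weak_map M j (weak_gen j a) = model_map M j a.
Proof. exact: weak_val_gen. Qed.

Lemma defined_one j : defined (One j).
Proof. by move=> M; exists (one (model_opd M) j tt). Qed.

Lemma weak_val_one M j : weak_val M (weak_cls (@defined_one j)) = one (model_opd M) j tt.
Proof. exact: weak_val_cls. Qed.

Program Definition weak_one : coll_map coll_unit L :=
  @CollMap coll_unit L (@GMap coll_unit L (fun j _ => weak_cls (@defined_one j)) _ _) _.
Next Obligation.
move=> j a; apply: weak_cell_ext => M; apply: etrans _ (esym (weak_val_face M false _)).
by rewrite !weak_val_one -gmap_face.
Qed.
Next Obligation.
move=> j a; apply: weak_cell_ext => M; apply: etrans _ (esym (weak_val_face M true _)).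
by rewrite !weak_val_one -gmap_face.
Qed.
Next Obligation. by move=> j []; apply: (weak_val_one terminal_model). Qed.

Lemma weak_map_one M j u : weak_map M j (weak_one j u) = one (model_opd M) j u.
Proof. by case: u; apply: weak_val_one. Qed.

(** To compose a class with a cell of [T L], represented by a raw composite of
    classes, one replaces the classes by their representatives. *)
Fixpoint paste j (x : raw L j) : term true j :=
  match x in raw _ j return term true j with
  | Rgen j q => Cell (weak_rep (q : weak_cell j))
  | Rid j x => Idt (paste x)
  | Rcomp i j x y => Cmp i (paste x) (paste y)
  end.

Lemma eval_paste M j (x : raw L j) :
  eval M (paste x) = ev (gcomp (free_unit _) (weak_map M)) x.
Proof.
elim: x => {j} [j q | j x /= -> | i j x /= -> y ->] //.
by rewrite /= weak_valP.
Qed.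

Lemma eval_pasteT M j (w : T L j) :
  eval M (paste (frep w)) = Some (fmap T (weak_map M) j w).
Proof. by rewrite eval_paste fevP. Qed.

Lemma eval_mul M j (p : tens L L j) :
  eval M (Mul (weak_rep (tfst p)) (paste (frep (tsnd p)))) =
  Some (mul (model_opd M) j (tens_map (weak_map M) (weak_map M) j p)).
Proof.
rewrite [LHS]/= weak_valP eval_pasteT; case: excluded_middle_informative => [h|[]].
  by apply: (f_equal (fun q => Some (mul (model_opd M) j q))); apply: tens_cell_eq.
exact: (tensP (tens_map (weak_map M) (weak_map M) j p)).
Qed.

Lemma defined_mul j (p : tens L L j) :
  defined (Mul (weak_rep (tfst p)) (paste (frep (tsnd p)))).
Proof. by move=> M; rewrite eval_mul; eexists. Qed.

Lemma weak_map_mul M j (p : tens L L j) :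
  weak_val M (weak_cls (defined_mul p)) = mul (model_opd M) j
    (tens_map (weak_map M) (weak_map M) j p).
Proof. by apply: weak_val_cls; apply: eval_mul. Qed.

Program Definition weak_mul : coll_map (tens L L) L :=
  @CollMap (tens L L) L (@GMap (tens L L) L (fun j p => weak_cls (defined_mul p)) _ _) _.
Next Obligation.
move=> j a; apply: weak_cell_ext => M; apply: etrans _ (esym (weak_val_face M false _)).
by rewrite !weak_map_mul -gmap_face -gmap_face.
Qed.
Next Obligation.
move=> j a; apply: weak_cell_ext => M; apply: etrans _ (esym (weak_val_face M true _)).
by rewrite !weak_map_mul -gmap_face -gmap_face.
Qed.
Next Obligation.
move=> j p; rewrite -[LHS]/(weak_val terminal_model _) weak_map_mul.
rewrite -[RHS](cmap_arity (coll_comp (mul terminal_opd)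
  (tens_map (weak_map terminal_model) (weak_map terminal_model)))).
by [].
Qed.

(** The axioms can be checked in the models, which separate classes by definition. *)
Definition weak_opd : monoid_on Coll_tensor L.
Proof.
apply: (@sep_monoid L weak_one weak_mul) => j q r h; apply: weak_cell_ext => M.
apply: (h _ (model_opd M) (weak_map M)) => i p; first exact: weak_map_one.
exact: weak_map_mul.
Defined.

Lemma weak_map_opd M : is_opd_map weak_opd (model_opd M) (weak_map M).
Proof.
by apply/is_opd_mapP; split=> j p; [apply: weak_map_one | apply: weak_map_mul].
Qed.
End WeaklyInitial.

(** * The sub-operad generated by a collection *)

Section Generated.
Context (A P : coll) (sP : monoid_on Coll_tensor P) (f : coll_map A P).

(** The sub-operads of [P] that contain the image of [f]. That a cell of [T P] has all
    its labels in [S] is expressed by a factorization through any globular set all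
    of whose cells map to [S]. *)
Record suboperad (S : forall j, P j -> Prop) : Prop := SubOperad {
  sub_face : forall c j (x : P j.+1), S _ x -> S _ (face c x);
  sub_gen : forall j a, S j (f j a);
  sub_one : forall j u, S j (one sP j u);
  sub_mul : forall j (p : tens P P j) (G : gset) (h : gmap G P) (w : T G j),
    S j (tfst p) -> (forall i x, S i (h i x)) -> tsnd p = fmap T h j w ->
    S j (mul sP j p)
}.

Definition generated j (x : P j) : Prop :=
  forall S : forall i, P i -> Prop, suboperad S -> S j x.

Lemma generated_suboperad : suboperad generated.
Proof.
split=> [c j x h S hS | j a S hS | j u S hS | j p G h w hp hh e S hS].
- by apply: (sub_face hS); apply: h.
- exact: sub_gen.
- exact: sub_one.
by apply: (sub_mul hS (h := h) (w := w)) => // [|i x]; [apply: hp | apply: hh].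
Qed.

Record gen_cell j := GenCell { gen_val : P j; gen_valP : generated gen_val }.

Lemma gen_cell_eq j (x y : gen_cell j) : gen_val x = gen_val y -> x = y.
Proof.
by case: x y => [x hx] [y hy] /= e; subst y; congr GenCell; apply: proof_irrelevance.
Qed.

Definition gen_face c j (x : gen_cell j.+1) : gen_cell j :=
  GenCell (sub_face generated_suboperad c (gen_valP x)).

Program Definition gen_gset : gset := @GSetObj gen_cell (gen_face false) (gen_face true) _
  _.
Next Obligation. by move=> j x; apply: gen_cell_eq; apply: src_tgt. Qed.
Next Obligation. by move=> j x; apply: gen_cell_eq; apply: tgt_src. Qed.

Definition gen_incl_gmap : gmap gen_gset P := @GMap gen_gset P gen_val (fun _ _ => erefl)
  (fun _ _ => erefl).

Definition gen_coll : coll := @CollObj gen_gset (gcomp (arity P) gen_incl_gmap).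
Local Notation G := gen_coll.

Definition gen_incl : coll_map G P := @CollMap G P gen_incl_gmap (fun _ _ => erefl).

Program Definition gen_fac_gmap (X : gset) (h : gmap X P)
    (hg : forall j x, generated (h j x)) : gmap X G :=
  @GMap X G (fun j x => GenCell (hg j x)) _ _.
Next Obligation. by move=> X h hg j x; apply: gen_cell_eq; apply: gmap_src. Qed.
Next Obligation. by move=> X h hg j x; apply: gen_cell_eq; apply: gmap_tgt. Qed.

Definition gen_fac (X : coll) (h : coll_map X P) (hg : forall j x, generated (h j x)) :
  coll_map X G := @CollMap X G (gen_fac_gmap hg) (cmap_arity h).

Definition gen_unit : coll_map A G := gen_fac (sub_gen generated_suboperad).

Definition gen_one : coll_map coll_unit G := gen_fac (sub_one generated_suboperad).

Lemma generated_mul j (p : tens G G j) :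
  generated (coll_comp (mul sP) (tens_map gen_incl gen_incl) j p).
Proof.
apply: (sub_mul generated_suboperad (h := gen_incl) (w := tsnd p)) => //.
  exact: (gen_valP (tfst p)).
by move=> i x; apply: (gen_valP x).
Qed.

Definition gen_mul : coll_map (tens G G) G := gen_fac generated_mul.

Definition gen_opd : monoid_on Coll_tensor G.
Proof.
apply: (@sep_monoid G gen_one gen_mul) => j q r h.
by apply: gen_cell_eq; apply: (h P sP gen_incl).
Defined.

Lemma gen_incl_opd : is_opd_map gen_opd sP gen_incl.
Proof. by apply/is_opd_mapP. Qed.

(** The cells at which two operad maps agree form a sub-operad; it contains the
    generators, hence everything. *)
Lemma gen_generates : generates gen_opd gen_unit.
Proof.
move=> Q sQ h h' /is_opd_mapP[h1 hM] /is_opd_mapP[h1' hM'] e.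
suff eqP' j (x : P j) (hx : generated x) : forall hx' : generated x, h j (GenCell hx') =
  h' j (GenCell hx').
  by apply: coll_map_eq => j [x hx]; apply: eqP'.
pose S i (y : P i) := exists hy : generated y, h i (GenCell hy) = h' i (GenCell hy).
suff [hy ey] : S j x by move=> hx'; rewrite (proof_irrelevance _ hx' hy).
apply: (hx S); split=> {j x hx} [c j x [hx ex] | j a | j u | j p D d w [hp ep] hd ew].
- exists (sub_face generated_suboperad c hx).
  rewrite -[GenCell _]/(gen_face c (GenCell hx)).
  have -> : gen_face c (GenCell hx) = face c (GenCell hx : G j.+1) by case: (c).
  by rewrite (gmap_face h) (gmap_face h') ex.
- by exists (sub_gen generated_suboperad a); apply: e.
- by exists (sub_one generated_suboperad u); rewrite -[GenCell _]/(one gen_opd j u) h1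
  h1'.
have hd' i y : generated (d i y) by have [] := hd i y.
have ehd i y : h i (GenCell (hd' i y)) = h' i (GenCell (hd' i y)).
  by have [hy ey] := hd i y; rewrite (proof_irrelevance _ (hd' i y) hy).
pose d' := gen_fac_gmap hd'.
have hq : arity G j (GenCell hp) = fmap T (bang G) j (fmap T d' j w).
  by rewrite Tmap_bang -(Tmap_bang d) -ew; apply: tensP.
pose q := @TensCell G G j (GenCell hp) (fmap T d' j w) hq.
have pq : tens_map gen_incl gen_incl j q = p.
  by apply: tens_cell_eq => //=; rewrite ew -TmapM; apply: Tmap_ext.
have hpm : generated (mul sP j p) by rewrite -pq; apply: generated_mul.
exists hpm; have -> : GenCell hpm = mul gen_opd j q.
  by apply: gen_cell_eq; apply: (f_equal (mul sP j) (esym pq)).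
rewrite hM hM'; apply: (f_equal (mul sQ j)); apply: tens_cell_eq; first exact: ep.
by rewrite /= -!TmapM; apply: Tmap_ext => i y; apply: ehd.
Qed.
End Generated.

(** The universal operad under [A] among the admissible ones. [Phi_sep] says that
    admissibility, like an equation, can be checked after jointly injective maps; it
    ensures that the universal map, which is built from all the admissible ones, is
    itself admissible. *)
Section FreeOperad.
Context (A : coll).
Context (Phi : forall P : coll, monoid_on Coll_tensor P -> coll_map A P -> Prop).
Context (Phi_t : Phi terminal_opd (terminal_map A)).
Context (Phi_sep : forall (P : coll) (sP : monoid_on Coll_tensor P) (f : coll_map A P),
  (forall j (x y : P j), (forall (Q : coll) (sQ : monoid_on Coll_tensor Q)
    (h : coll_map P Q),
     is_opd_map sP sQ h -> Phi sQ (coll_comp h f) -> h j x = h j y) ->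
     x = y) -> Phi sP f).

Definition free_coll : coll := gen_coll (weak_opd Phi_t) (weak_gen Phi_t).
Definition free_opd : monoid_on Coll_tensor free_coll :=
  gen_opd (weak_opd Phi_t) (weak_gen Phi_t).
Definition free_gen : coll_map A free_coll := gen_unit (weak_opd Phi_t) (weak_gen Phi_t).

Lemma free_exists (P : coll) (sP : monoid_on Coll_tensor P) (f : coll_map A P) :
  Phi sP f -> exists h : coll_map free_coll P,
    is_opd_map free_opd sP h /\ forall j a, h j (free_gen j a) = f j a.
Proof.
move=> hf; pose M := Model hf.
exists (coll_comp (weak_map Phi_t M) (gen_incl (weak_opd Phi_t) (weak_gen Phi_t))); split.
  exact: (is_monoid_map_cmp (weak_map_opd Phi_t M) (gen_incl_opd _ _)).
by move=> j a; apply: (weak_map_gen Phi_t M).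
Qed.

Lemma free_gen_Phi : Phi free_opd free_gen.
Proof.
apply: Phi_sep => j x y e; apply: gen_cell_eq; apply: weak_cell_ext => M.
pose h := coll_comp (weak_map Phi_t M) (gen_incl (weak_opd Phi_t) (weak_gen Phi_t)).
apply: (e _ (model_opd M) h).
  exact: (is_monoid_map_cmp (weak_map_opd Phi_t M) (gen_incl_opd _ _)).
have -> : coll_comp h free_gen = model_map M by apply: coll_map_eq => i a;
  apply: (weak_map_gen Phi_t M).
exact: modelP.
Qed.

Lemma free_generates : generates free_opd free_gen.
Proof. exact: gen_generates. Qed.
End FreeOperad.

(** * Maps to the underlying object of Opd_(k-1) *)

(** A morphism [X -> N_k Y] is a map of collections that satisfies this condition.
    Working with the map avoids the case distinction in the definition of [N_k]. *)
Definition over_map k : forall (X : Opd_pred k) (Y : Opd_ k),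
    coll_map (underlying_pred k X) (mcar Y) -> Prop :=
  match k return forall (X : Opd_pred k) (Y : Opd_ k),
    coll_map (underlying_pred k X) (mcar Y) -> Prop with
  | 0 => fun X Y f => True
  | k'.+1 => fun X Y f => is_kopd_map k' (mstr X) (kopd_restrict (mstr Y)) (tr_map k' f)
  end.

Definition under k : forall (X : Opd_pred k) (Y : Opd_ k), hom X (N_ k Y) ->
    coll_map (underlying_pred k X) (mcar Y) :=
  match k return forall (X : Opd_pred k) (Y : Opd_ k), hom X (N_ k Y) ->
    coll_map (underlying_pred k X) (mcar Y) with
  | 0 => fun X Y f => f
  | k'.+1 => fun X Y f => mmap f
  end.

Lemma under_over k (X : Opd_pred k) (Y : Opd_ k) (f : hom X (N_ k Y)) :
  over_map (under f).
Proof. by case: k X Y f => // k X Y f; apply: (@mmapP _ _ _ _ X (N_succ k Y) f). Qed.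

Definition over_hom k : forall (X : Opd_pred k) (Y : Opd_ k)
    (f : coll_map (underlying_pred k X) (mcar Y)), over_map f -> hom X (N_ k Y) :=
  match k return forall (X : Opd_pred k) (Y : Opd_ k)
    (f : coll_map (underlying_pred k X) (mcar Y)), over_map f -> hom X (N_ k Y) with
  | 0 => fun X Y f _ => f
  | k'.+1 => fun X Y f hf => @MonoidOverMap _ _ _ _ X (N_succ k' Y) f hf
  end.

Lemma under_hom k (X : Opd_pred k) (Y : Opd_ k) f (hf : @over_map k X Y f) :
  under (over_hom hf) = f.
Proof. by case: k X Y f hf. Qed.

Lemma under_inj k (X : Opd_pred k) (Y : Opd_ k) (f g : hom X (N_ k Y)) :
  under f = under g -> f = g.
Proof.
by case: k X Y f g => // k X Y f g;
  apply: (@monoid_over_map_eq _ _ _ _ X (N_succ k Y) f g).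
Qed.

Lemma under_comp k (X : Opd_pred k) (Y Y' : Opd_ k) (h : hom Y Y') (f : hom X (N_ k Y)) :
  under (fmap (N_ k) h ∘ f) = coll_comp (mmap h) (under f).
Proof. by case: k X Y Y' h f. Qed.

(** Only the truncation of [Y] matters here, so a map of [k]-operads can be composed
    with a map over [N_k] even if it does not come from a map of collections. *)
Lemma over_trans k (X : Opd_pred k) (Y Y' : Opd_ k)
    (f : coll_map (underlying_pred k X) (mcar Y))
      (f' : coll_map (underlying_pred k X) (mcar Y'))
    (g : coll_map (tr_coll k (mcar Y)) (tr_coll k (mcar Y'))) :
  is_kopd_map k (mstr Y) (mstr Y') g ->
  (forall j (x : cells (underlying_pred k X) j) (h : j <= k), f' j x =
    tval (g j (TrCell (f j x) h))) ->
  @over_map k X Y f -> @over_map k X Y' f'.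
Proof.
case: k X Y Y' f f' g => // k X Y Y' f f' g [g1 gM] ff' [f1 fM]; split;
  apply: coll_map_eq => j x; apply: tr_cell_eq.
  have jk : j <= k.+1 := leqW (tle x).
  apply: etrans (ff' _ _ jk) _; congr tval.
  apply: etrans _ (f_equal (fun h : coll_map (tr_coll k.+1 coll_unit) _ =>
    h j (tr_incl_succ k _ j x)) g1).
  apply: (f_equal (g j)); apply: tr_cell_eq.
  exact: (f_equal (fun h : coll_map (tr_coll k coll_unit) (tr_coll k (mcar Y)) =>
    tval (h j x)) f1).
have jk : j <= k.+1 := leqW (tle (tfst x)).
apply: etrans (ff' _ _ jk) _.
pose x' := tens_map (tr_incl_succ k _) (tr_incl_succ k _) j
  (tens_map (tr_map k f) (tr_map k f) j x).
apply: (@etrans _ _ (tval (g j (mul (mstr Y) j x')))).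
  congr tval; apply: (f_equal (g j)); apply: tr_cell_eq.
  exact: (f_equal (fun h : coll_map (tens (tr_coll k (mcar X)) (tr_coll k (mcar X)))
    (tr_coll k (mcar Y)) => tval (h j x)) fM).
apply: etrans (f_equal (fun h : coll_map (tens (tr_coll k.+1 (mcar Y))
  (tr_coll k.+1 (mcar Y)))
  (tr_coll k.+1 (mcar Y')) => tval (h j x')) gM) _.
apply: (f_equal (fun q => tval (mul (mstr Y') j q))).
rewrite /x' [LHS]tens_mapM [LHS]tens_mapM [RHS]tens_mapM.
by apply: tens_map_ext => m a; apply: tr_cell_eq; rewrite /= (ff' _ _ (leqW (tle a)));
  congr tval; apply: (f_equal (g m)); apply: tr_cell_eq.
Qed.

(** Preserving operations is a family of equations between cells of [Y], which jointly
    injective maps reflect. *)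
Lemma over_sep k (X : Opd_pred k) (Y : Opd_ k)
  (f : coll_map (underlying_pred k X) (mcar Y)) :
  (forall j (x y : mcar Y j), (forall (Y' : Opd_ k) (h : hom Y Y'),
     @over_map k X Y' (coll_comp (mmap h) f) -> mmap h j x = mmap h j y) -> x = y) ->
  @over_map k X Y f.
Proof.
case: k X Y f => // k X Y f sep; split; apply: coll_map_eq => j x; apply: tr_cell_eq;
  apply: sep => Y' h [hf1 hfM]; have [h1 hM] := kopd_restrict_map (mmapP h).
  apply: etrans (f_equal (fun g : coll_map (tr_coll k coll_unit) (tr_coll k (mcar Y')) =>
    tval (g j x)) hf1) _.
  exact/esym/(f_equal (fun g : coll_map (tr_coll k coll_unit) (tr_coll k (mcar Y')) =>
    tval (g j x)) h1).
apply: etrans (f_equal (fun g : coll_map (tens (tr_coll k (mcar X)) (tr_coll k (mcar X)))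
  (tr_coll k (mcar Y')) => tval (g j x)) hfM) _.
apply/esym; apply: etrans (f_equal (fun g : coll_map
  (tens (tr_coll k (mcar Y)) (tr_coll k (mcar Y))) (tr_coll k (mcar Y')) =>
  tval (g j (tens_map (tr_map k f) (tr_map k f) j x))) hM) _.
apply: (f_equal (fun q => tval (mul (kopd_restrict (mstr Y')) j q))).
by rewrite [LHS]tens_mapM; apply: tens_map_ext => m a; apply: tr_cell_eq.
Qed.

Definition opd_of (P : coll) (sP : monoid_on Coll_tensor P) : Opd :=
  @MonoidOver Coll Coll Coll_tensor (functor_id Coll) P sP.

Definition over_opd k (X : Opd_pred k) (P : coll) (sP : monoid_on Coll_tensor P)
    (f : coll_map (underlying_pred k X) P) : Prop :=
  @over_map k X (restriction k (opd_of sP)) f.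

Lemma tr_terminal_uniq k (X : coll) (f g : coll_map X (tr_coll k terminal_coll)) : f = g.
Proof.
apply: coll_map_eq => j x; apply: tr_cell_eq.
exact: etrans (cmap_arity f x) (esym (cmap_arity g x)).
Qed.

Lemma over_opd_terminal k (X : Opd_pred k) : over_opd (X := X) terminal_opd
  (terminal_map _).
Proof. by case: k X => // k X; split; apply: tr_terminal_uniq. Qed.

Lemma over_opd_sep k (X : Opd_pred k) (P : coll) (sP : monoid_on Coll_tensor P)
    (f : coll_map (underlying_pred k X) P) :
  (forall j (x y : P j), (forall (Q : coll) (sQ : monoid_on Coll_tensor Q)
    (h : coll_map P Q),
     is_opd_map sP sQ h -> over_opd sQ (coll_comp h f) -> h j x = h j y) ->
     x = y) -> over_opd sP f.
Proof.
move=> sep; apply: over_sep => j x y e; apply: sep => Q sQ h hM hf.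
exact: (e (restriction k (opd_of sQ))
  (fmap (restriction k) (@MonoidOverMap _ _ _ _ (opd_of sP) (opd_of sQ) h hM))).
Qed.

(** * Gluing low cells of an operad to high cells of a collection *)

(** The low cells of [L] and the high cells of [A], where the boundary of a high cell
    is transported along [u]: the pushout of [A] and the truncation of [L] under the
    truncation of [A]. *)
Section Glue.
Context (k : nat) (A L : coll) (u : coll_map A L) (sL : monoid_on Coll_tensor L).

Inductive glue_cell j :=
| Low (x : L j) of j <= k
| High (a : A j) of k < j.

Definition low_or_high j : {j <= k} + {k < j}.
Proof. by case: (leqP j k); [left | right]. Defined.

Definition glue_in j (a : A j) : glue_cell j :=
  match low_or_high j with
  | left h => Low (u j a) h
  | right h => High a h
  end.

Lemma glue_in_low j (a : A j) (h : j <= k) : glue_in a = Low (u j a) h.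
Proof.
rewrite /glue_in; case: low_or_high => h'; first by rewrite (bool_irrelevance h' h).
by exfalso; rewrite ltnNge h in h'.
Qed.

Lemma glue_in_high j (a : A j) (h : k < j) : glue_in a = High a h.
Proof.
rewrite /glue_in; case: low_or_high => h'; last by rewrite (bool_irrelevance h' h).
by exfalso; rewrite ltnNge h' in h.
Qed.

Definition glue_face (c : bool) j (z : glue_cell j.+1) : glue_cell j :=
  match z with
  | Low x h => Low (face c x) (ltnW h)
  | High a _ => glue_in (face c a)
  end.

Lemma glue_in_face c j (a : A j.+1) : glue_in (face c a) = glue_face c (glue_in a).
Proof.
case: (low_or_high j.+1) => h; last by rewrite (glue_in_high a h).
by rewrite (glue_in_low a h) (glue_in_low _ (ltnW h)) /= gmap_face.
Qed.

Lemma glue_face_face b c j (z : glue_cell j.+2) : glue_face b (glue_face c z) =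
  glue_face b (glue_face false z).
Proof.
case: z => [x h | a h] /=; first by congr Low; apply: face_face.
by rewrite -!glue_in_face face_face.
Qed.

Definition glue_gset : gset :=
  @GSetObj glue_cell (glue_face false) (glue_face true)
    (fun j z => esym (glue_face_face false true z))
      (fun j z => esym (glue_face_face true true z)).

Definition glue_arity j (z : glue_cell j) : T gone j :=
  match z with Low x _ => arity L j x | High a _ => arity A j a end.

Lemma glue_arity_in j (a : A j) : glue_arity (glue_in a) = arity A j a.
Proof. by rewrite /glue_in; case: low_or_high => h //=; apply: cmap_arity. Qed.

Lemma glue_arity_face c j (z : glue_cell j.+1) : glue_arity (glue_face c z) =
  face c (glue_arity z).
Proof. by case: z => [x h|a h] /=; rewrite ?glue_arity_in gmap_face. Qed.

Definition glue_coll : coll :=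
  @CollObj glue_gset (@GMap glue_gset (T gone) glue_arity (glue_arity_face false)
    (glue_arity_face true)).
Local Notation Z := glue_coll.

Definition glue_unit : coll_map A Z :=
  @CollMap A Z (@GMap A Z glue_in (glue_in_face false) (glue_in_face true)) glue_arity_in.

Program Definition glue_incl : coll_map (tr_coll k L) Z :=
  @CollMap (tr_coll k L) Z
    (@GMap (tr_coll k L) Z (fun j x => Low (tval x) (tle x)) _ _) (fun _ _ => erefl).
Next Obligation. by []. Qed.
Next Obligation. by []. Qed.

Definition glue_val j (z : glue_cell j) : L j :=
  match z with Low x _ => x | High a _ => u j a end.

Lemma glue_val_in j (a : A j) : glue_val (glue_in a) = u j a.
Proof. by rewrite /glue_in; case: low_or_high. Qed.

Lemma glue_val_face c j (z : glue_cell j.+1) : glue_val (glue_face c z) =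
  face c (glue_val z).
Proof. by case: z => [x h|a h] //=; rewrite glue_val_in gmap_face. Qed.

Program Definition glue_low : coll_map (tr_coll k Z) (tr_coll k L) :=
  @CollMap (tr_coll k Z) (tr_coll k L) (@GMap (tr_coll k Z) (tr_coll k L)
    (fun j z => @TrCell L k j (glue_val (tval z)) (tle z)) _ _) _.
Next Obligation. by move=> j z; apply: tr_cell_eq; apply: (glue_val_face false). Qed.
Next Obligation. by move=> j z; apply: tr_cell_eq; apply: (glue_val_face true). Qed.
Next Obligation. by move=> j [[x h|a h] hj] //=; apply: cmap_arity. Qed.

Lemma glue_incl_low j (z : tr_coll k Z j) : glue_incl j (glue_low j z) = tval z.
Proof.
case: z => [[x h|a h] hj] /=; first by rewrite (bool_irrelevance h hj).
by exfalso; rewrite ltnNge hj in h.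
Qed.

Lemma glue_incl_inj j (x y : tr_coll k L j) : glue_incl j x = glue_incl j y -> x = y.
Proof. by case=> /tr_cell_eq. Qed.

Definition glue_kopd : monoid_on (KColl_tensor k) (tr_coll k Z) :=
  @restrict_monoid k Z (tr_coll k L) (tr_coll k coll_unit) glue_incl glue_low
    glue_incl_inj glue_incl_low
    (coll_id _) (one (opd_restrict k sL)) (mul (opd_restrict k sL))
    (@kopd_assoc k _ _) (@kopd_one_l k _ _) (@kopd_one_r k _ _).

Lemma glue_low_kopd : is_kopd_map k glue_kopd (opd_restrict k sL) glue_low.
Proof. by split; apply: coll_map_eq => j p; apply: tr_cell_eq. Qed.

Definition glue_incl_tr : coll_map (tr_coll k L) (tr_coll k Z) :=
  @restrict_map k Z Z (coll_id Z) (tr_coll k L) glue_incl.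

Lemma glue_lowK : coll_comp glue_incl_tr glue_low = coll_id (tr_coll k Z).
Proof. by apply: coll_map_eq => j z; apply: tr_cell_eq; apply: glue_incl_low. Qed.

Lemma glue_incl_trK : coll_comp glue_low glue_incl_tr = coll_id (tr_coll k L).
Proof. by apply: coll_map_eq => j z; apply: tr_cell_eq. Qed.

Lemma glue_incl_tr_kopd : is_kopd_map k (opd_restrict k sL) glue_kopd glue_incl_tr.
Proof.
exact: (is_monoid_map_inv (C := KCollCat k) (t := KColl_tensor k) glue_incl_trK glue_lowK
  glue_low_kopd).
Qed.

Section Out.
Context (Y : coll) (f : coll_map A Y) (g : coll_map (tr_coll k L) (tr_coll k Y)).
Context (fg : forall j a (h : j <= k), tval (g j (TrCell (u j a) h)) = f j a).

Definition glue_out_fun j (z : glue_cell j) : Y j :=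
  match z with Low x h => tval (g j (TrCell x h)) | High a _ => f j a end.

Lemma glue_out_in j (a : A j) : glue_out_fun (glue_in a) = f j a.
Proof. by rewrite /glue_in; case: low_or_high => h //=; apply: fg. Qed.

Lemma glue_out_face c j (z : glue_cell j.+1) : glue_out_fun (glue_face c z) =
  face c (glue_out_fun z).
Proof.
case: z => [x h|a h] /=; last by rewrite glue_out_in gmap_face.
rewrite -tval_face -gmap_face; congr (tval (g j _)).
by apply: tr_cell_eq; rewrite tval_face.
Qed.

Program Definition glue_out : coll_map Z Y :=
  @CollMap Z Y (@GMap Z Y glue_out_fun (glue_out_face false) (glue_out_face true)) _.
Next Obligation.
by move=> j [x h|a h]; [apply: (cmap_arity g) | apply: cmap_arity].
Qed.

Lemma glue_out_low : tr_map k glue_out = coll_comp g glue_low.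
Proof.
apply: coll_map_eq => j [[x h|a h] hj]; apply: tr_cell_eq => /=.
  by rewrite (bool_irrelevance h hj).
by exfalso; rewrite ltnNge hj in h.
Qed.
End Out.

Lemma glue_map_ext (Y : coll) (h h' : coll_map Z Y) :
  (forall j a, h j (glue_unit j a) = h' j (glue_unit j a)) ->
  (forall j x, h j (glue_incl j x) = h' j (glue_incl j x)) -> h = h'.
Proof.
move=> e1 e2; apply: coll_map_eq => j [x hj|a hj]; first exact: (e2 j (TrCell x hj)).
by have := e1 j a; rewrite /= (glue_in_high a hj).
Qed.
End Glue.

(** * The left adjoint M_k *)

Definition opd_cosk k (Y : Opd_ k) : Opd := opd_of (copd_opd (mstr Y)).

Definition opd_cosk_unit k (Y : Opd_ k) : hom Y (restriction k (opd_cosk Y)) :=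
  @MonoidOverMap _ _ _ _ Y (restriction k (opd_cosk Y)) (copd_unit k (mcar Y))
    (copd_unit_kopd (mstr Y)).

Section FreeLevel.
Context (k : nat) (X : Opd_pred k).
Local Notation A := (underlying_pred k X : coll).

Definition free_over : coll := free_coll (over_opd_terminal X).
Definition free_over_opd : monoid_on Coll_tensor free_over :=
  free_opd (over_opd_terminal X).
Definition free_over_unit : coll_map A free_over := free_gen (over_opd_terminal X).

Lemma free_over_unitP : @over_map k X (restriction k (opd_of free_over_opd))
  free_over_unit.
Proof. exact: (free_gen_Phi (over_opd_terminal X) (@over_opd_sep k X)). Qed.

Lemma free_over_generates : generates free_over_opd free_over_unit.
Proof. exact: free_generates. Qed.

Definition M_obj : Opd_ k :=
  @MonoidOver _ _ (KColl_tensor k) (truncation k) (glue_coll k free_over_unit)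
    (glue_kopd k free_over_unit free_over_opd).

Lemma glue_unit_over : @over_map k X M_obj (glue_unit k free_over_unit).
Proof.
apply: (@over_trans k X (restriction k (opd_of free_over_opd)) M_obj free_over_unit
  (glue_unit k free_over_unit)
  (glue_incl_tr k free_over_unit) (glue_incl_tr_kopd k free_over_unit free_over_opd) _
    free_over_unitP).
by move=> j x h; apply: glue_in_low.
Qed.

Definition M_unit : hom X (N_ k M_obj) := over_hom glue_unit_over.

(** Composing with the map from [Y] to its coskeleton yields an admissible map from
    [X] to an operad. It factors through the free operad; the truncation of the
    resulting map takes values in [Y]. *)
Lemma level_map_exists (Y : Opd_ k) (f : coll_map A (mcar Y)) : @over_map k X Y f ->
  exists g : coll_map (tr_coll k free_over) (tr_coll k (mcar Y)),
    is_kopd_map k (opd_restrict k free_over_opd) (mstr Y) g /\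
    forall j a (h : j <= k), tval (g j (TrCell (free_over_unit j a) h)) = f j a.
Proof.
move=> fY.
have hf : over_opd (X := X) (copd_opd (mstr Y)) (coll_comp (copd_unit k (mcar Y)) f).
  exact: (@over_trans k X Y (restriction k (opd_cosk Y)) f _ _ (copd_unit_kopd (mstr Y)) _
    fY).
have [h [hM hu]] := free_exists (over_opd_terminal X) hf.
exists (copd_part h); split; first exact: copd_part_kopd.
by move=> j a jk; rewrite (copd_partE (y := TrCell (f j a) jk)) ?hu.
Qed.

Lemma M_exists (Y : Opd_ k) (f : hom X (N_ k Y)) :
  exists g : hom M_obj Y, fmap (N_ k) g ∘ M_unit = f.
Proof.
have [g [gM gu]] := level_map_exists (under_over f).
have hM : is_kopd_map k (glue_kopd k free_over_unit free_over_opd) (mstr Y)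
  (tr_map k (glue_out gu)).
  by rewrite glue_out_low; apply: (is_monoid_map_cmp gM
    (glue_low_kopd k free_over_unit free_over_opd)).
exists (@MonoidOverMap _ _ _ _ M_obj Y (glue_out gu) hM).
apply: under_inj; rewrite under_comp under_hom; apply: coll_map_eq => j a.
exact: glue_out_in.
Qed.

(** High cells of [M_k X] come from [X], and the truncation of the free operad
    inherits its uniqueness property. *)
Lemma M_uniq (Y : Opd_ k) (g g' : hom M_obj Y) :
  fmap (N_ k) g ∘ M_unit = fmap (N_ k) g' ∘ M_unit -> g = g'.
Proof.
move=> /(f_equal (@under _ _ _)); rewrite !under_comp under_hom => e.
have {}e j a : mmap g j (glue_unit k free_over_unit j a) =
  mmap g' j (glue_unit k free_over_unit j a).
  exact: (f_equal (fun h : coll_map _ _ => h j a) e).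
apply: monoid_over_map_eq; apply: glue_map_ext => // j x.
have E : coll_comp (tr_map k (mmap g)) (glue_incl_tr k free_over_unit) =
         coll_comp (tr_map k (mmap g')) (glue_incl_tr k free_over_unit).
  apply: (generates_low free_over_generates).
  - exact: (is_monoid_map_cmp (mmapP g) (glue_incl_tr_kopd k free_over_unit
    free_over_opd)).
  - exact: (is_monoid_map_cmp (mmapP g') (glue_incl_tr_kopd k free_over_unit
    free_over_opd)).
  by move=> i a h; apply: tr_cell_eq; rewrite /= -(glue_in_low free_over_unit a h);
    apply: e.
exact: (f_equal (fun h : coll_map (tr_coll k free_over) (tr_coll k (mcar Y)) =>
  tval (h j x)) E).
Qed.
End FreeLevel.

Definition M_lift k X Y (f : hom X (N_ k Y)) : hom (M_obj X) Y :=
  sval (constructive_indefinite_description _ (M_exists f)).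

Lemma M_liftP k X Y (f : hom X (N_ k Y)) : fmap (N_ k) (M_lift f) ∘ M_unit X = f.
Proof. by rewrite /M_lift; case: constructive_indefinite_description. Qed.

Lemma M_lift_uniq k X Y (g : hom (@M_obj k X) Y) : M_lift (fmap (N_ k) g ∘ M_unit X) = g.
Proof. by apply: M_uniq; rewrite M_liftP. Qed.

Definition M_adj k : left_adjoint (N_ k) :=
  @universal_left_adjoint (Opd_ k) (Opd_pred k) (N_ k) (@M_obj k) (@M_unit k) (@M_lift k)
    (@M_liftP k) (@M_lift_uniq k).

(** * Dimensions other than k, and the chain of adjunctions *)

(** The coskeleton of [X] is an operad under [X], and the structure of [X] is
    preserved. So the free operad maps to it, and up to dimension [k] this is a map
    back to [X]. It is inverse to the unit since both composites fix the
    generators. *)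
Lemma free_over_low_inverse k (X : Opd_ k) :
  exists g : coll_map (tr_coll k (@free_over k.+1 X)) (tr_coll k (mcar X)),
    coll_comp g (tr_map k (@free_over_unit k.+1 X)) = coll_id _ /\
    coll_comp (tr_map k (@free_over_unit k.+1 X)) g = coll_id _.
Proof.
have hX : @over_map k.+1 X (restriction k.+1 (opd_cosk X)) (copd_unit k (mcar X)).
  by rewrite /over_map kopd_opd_restrict; apply: copd_unit_kopd.
have [h [hM hu]] := free_exists (@over_opd_terminal k.+1 X) hX.
pose g := copd_part h.
have gM : is_kopd_map k (opd_restrict k (@free_over_opd k.+1 X)) (mstr X) g.
  exact: copd_part_kopd.
have uM : is_kopd_map k (mstr X) (opd_restrict k (@free_over_opd k.+1 X))
    (tr_map k (@free_over_unit k.+1 X)).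
  by rewrite -kopd_opd_restrict; apply: (@free_over_unitP k.+1 X).
have gu j (x : tr_coll k (mcar X) j) : g j (tr_map k (@free_over_unit k.+1 X) j x) = x.
  by apply: copd_partE; apply: hu.
exists g; split; first by apply: coll_map_eq.
apply: (generates_low (@free_over_generates k.+1 X)).
- exact: (is_monoid_map_cmp uM gM).
- exact: (is_monoid_map_id (C := KCollCat k)).
move=> j a jk; exact: (f_equal (tr_map k (@free_over_unit k.+1 X) j)
  (gu j (TrCell a jk))).
Qed.

(** Below dimension [k] the unit is that of the free operad, and above it is an
    inclusion of cells of [X] to which nothing has been added. *)
Lemma glue_unit_bij k (X : Opd_pred k) m : m <> k ->
  bijective (glue_unit k (free_over_unit X) m).
Proof.
move=> mk; apply: inj_surj_bij; case: (leqP m k) => mk'.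
- case: k X mk mk' => [|k] X; first by case: m.
  move=> mk mk'; have {}mk : m <= k by rewrite -ltnS ltn_neqAle mk' andbT; apply/eqP.
  have [g [gu _]] := free_over_low_inverse X.
  move=> a b E; have e : free_over_unit (k := k.+1) X m a =
    free_over_unit (k := k.+1) X m b.
    by rewrite -!(glue_val_in k.+1); apply: (f_equal (@glue_val k.+1 _ _ _ m) E).
  have ga c : tval (g m (TrCell (free_over_unit X m c) mk)) = c.
    exact: (f_equal (fun h : coll_map (tr_coll k (mcar X)) (tr_coll k (mcar X)) =>
      tval (h m (TrCell c mk))) gu).
  by rewrite -(ga a) e ga.
- by move=> a b; rewrite /= !(glue_in_high _ _ mk') => -[].
- case=> [x h | a h]; last by exfalso; rewrite ltnNge mk' in h.
  case: k X mk mk' x h => [|k] X; first by case: m.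
  move=> mk mk' x h; have {}mk : m <= k by rewrite -ltnS ltn_neqAle mk' andbT; apply/eqP.
  have [g [_ ug]] := free_over_low_inverse X.
  exists (tval (g m (TrCell x mk))); rewrite /= (glue_in_low _ _ h); congr Low.
  exact: (f_equal (fun h : coll_map (tr_coll k (@free_over k.+1 X))
    (tr_coll k (@free_over k.+1 X)) => tval (h m (TrCell x mk))) ug).
case=> [x h | a h]; first by exfalso; rewrite ltnNge h in mk'.
by exists a; rewrite /= (glue_in_high _ _ h).
Qed.

Section Chain.
Context (M_ : forall k, left_adjoint (N_ k)) (A : coll).

(** This and the next lemma: the composite of the adjunctions makes the object at the
    end of the chain universal among the objects of [Opd_k] under [A]. *)
Lemma chain_exists k (Y : Opd_ k) (f : coll_map A (mcar Y)) :
  exists g : hom (M_chain M_ A k) Y, mmap g ∘ M_chain_unit M_ A k = f.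
Proof.
elim: k Y f => [|k IH] Y f;
  first exact: (ladj_exists (M_ 0) (f : hom (A : Coll) (N_ 0 Y))).
have [g' e'] := IH (N_succ k Y) f.
have [g e] := ladj_exists (M_ k.+1) (g' : hom (M_chain M_ A k : Opd_pred k.+1)
  (N_ k.+1 Y)).
by exists g; rewrite -e' -e [LHS]cmpA.
Qed.

Lemma chain_uniq k (Y : Opd_ k) (g g' : hom (M_chain M_ A k) Y) :
  mmap g ∘ M_chain_unit M_ A k = mmap g' ∘ M_chain_unit M_ A k -> g = g'.
Proof.
elim: k Y g g' => [|k IH] Y g g' e; first exact: (@ladj_uniq _ _ _ (M_ 0) A Y).
apply: (@ladj_uniq _ _ _ (M_ k.+1) (M_chain M_ A k)).
by apply: (IH (N_succ k Y)); move: e; rewrite ![_ ∘ M_chain_unit _ _ k.+1]cmpA.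
Qed.

(** The universal property of the chain gives a map of [k]-operads [phi] to the
    truncation of [M A]; that of [M A], applied to the coskeleton of the chain, gives
    a map back. Both composites fix [A], hence are identities: one because [M A] is
    generated by [A] even after truncation, the other by uniqueness for maps from the
    chain to its coskeleton. *)
Lemma chain_iso (M : left_adjoint N) k :
  exists phi : hom (underlying_kopd k (M_chain M_ A k))
                   (underlying_kopd k (restriction k (M A))),
    is_iso phi /\
    mmap phi ∘ fmap (truncation k) (M_chain_unit M_ A k) =
      fmap (truncation k) (lunit M A).
Proof.
pose C := M_chain M_ A k; pose P := M A.
have [phi phiE] := @chain_exists k (restriction k P) (lunit M A).
have [psi psiE] := ladj_exists M (coll_comp (copd_unit k (mcar C)) (M_chain_unit M_ A k) :
  hom (A : Coll) (N (opd_cosk C))).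
have gen : generates (mstr P) (lunit M A).
  move=> Q sQ h h' hM hM' e.
  apply: (f_equal (@mmap _ _ _ _ _ _) (x := @MonoidOverMap _ _ _ _ P (opd_of sQ) h hM)
    (y := @MonoidOverMap _ _ _ _ P (opd_of sQ) h' hM')).
  by apply: (ladj_uniq (F := M)); apply: coll_map_eq.
pose g := copd_part (mmap psi).
have gM : is_kopd_map k (opd_restrict k (mstr P)) (mstr C) g.
  exact: copd_part_kopd (mmapP psi).
have phia j a : mmap phi j (M_chain_unit M_ A k j a) = lunit M A j a.
  exact: (f_equal (fun h : coll_map _ _ => h j a) phiE).
have psia j a : mmap psi j (lunit M A j a) = copd_unit k (mcar C) j
  (M_chain_unit M_ A k j a).
  exact: (f_equal (fun h : coll_map _ _ => h j a) psiE).
exists (fmap (underlying_kopd k) phi); split; last first.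
  by rewrite -[mmap _]/(fmap (truncation k) (mmap phi)) -fmapM phiE.
apply: (@kopd_iso k _ _ (fmap (underlying_kopd k) phi) g).
  apply: (generates_low gen).
  - exact: (is_monoid_map_cmp (mmapP phi) gM).
  - exact: (is_monoid_map_id (C := KCollCat k)).
  move=> j a jk; apply: tr_cell_eq; rewrite -[RHS]phia.
  have ga : g j (TrCell (lunit M A j a) jk) = TrCell (M_chain_unit M_ A k j a) jk.
    by apply: copd_partE; apply: psia.
  exact: (f_equal (fun y : tr_coll k (mcar C) j => mmap phi j (tval y)) ga).
have e : fmap (restriction k) psi ∘ phi = opd_cosk_unit C.
  apply: chain_uniq; apply: coll_map_eq => j a.
  by rewrite /= phia psia.
apply: coll_map_eq => j x; apply: copd_partE.
exact: (f_equal (fun h : hom C (restriction k (opd_cosk C)) => mmap h j (tval x)) e).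
Qed.
End Chain.

Theorem proposition2p1 :
  exists M_ : forall k : nat, left_adjoint (N_ k),
    (forall (k : nat) (X : Opd_pred k) (m : nat), m <> k ->
       bijective_at m (fmap (underlying_pred k) (lunit (M_ k) X))) /\
    (forall (k : nat) (X : Opd_ k),
       is_iso (fmap (underlying_kopd k) (lunit (M_ k.+1) X))) /\
    (forall (M : left_adjoint N) (k : nat) (A : Coll),
       exists phi : hom (underlying_kopd k (M_chain M_ A k))
                        (underlying_kopd k (restriction k (M A))),
         is_iso phi /\
         mmap phi ∘ fmap (truncation k) (M_chain_unit M_ A k) =
           fmap (truncation k) (lunit M A)).
Proof.
exists M_adj; split; [|split].
- move=> k X m mk; have := @glue_unit_bij k X m mk.
  by case: k X {mk} => [|k] X.
- move=> k X.
  have [g [fg gf]] : exists g,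
    coll_comp (tr_map k (glue_unit k.+1 (@free_over_unit k.+1 X))) g = coll_id _ /\
      coll_comp g (tr_map k (glue_unit k.+1 (@free_over_unit k.+1 X))) = coll_id _.
    apply: coll_inverse => j; apply: tr_map_bij => jk.
    by apply: glue_unit_bij => e; rewrite e ltnn in jk.
  exact: (@kopd_iso k _ _ (fmap (underlying_kopd k) (lunit (M_adj k.+1) X)) g).
by move=> M k A; apply: chain_iso.
Qed.
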